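(* Let $m,n,r,l$ be positive integers with $r\le l<\min(m,n)$, $n>36r$ and $l>22(r-1)$. Let $G$ be an $r\times n$ Gaussian random matrix and let $H\in\mathbb R^{n\times l}$, $A\in\mathbb R^{m\times r}$ and $E\in\mathbb R^{m\times n}$ be constant matrices, where $A$ has full rank $r$. Put $B=\frac1{\sqrt n}G$, $\tilde M=AB$ and $M=\tilde M+E$. Let $T\in\mathbb R^{l\times l}$ be nonsingular, and let $X=MHT^{-1}$ and $Y=X^+M$ be the output of the column-sketching low rank approximation algorithm applied to $M$ with the sketch matrix $H$. Let $|||\cdot|||$ denote either the spectral norm or the Frobenius norm. (i) If $H$ has orthonormal columns and if $\|E\|_F\le\frac{\sigma_r(A)}{48\sqrt{n/l}+6}$, then $$|||M-XY|||/\tilde\sigma_{r+1}(M)\le\sqrt{1+100\,n/l}$$ with a probability no less than $1-\exp(-\frac{l-r}{20})-\exp(-\frac{n-r}{20})-\exp(-\frac n{72})$. (ii) If $H$ has full rank and if $\|E\|_F\le\frac{\sigma_r(A)}{12}\min\Big(1,\frac{1}{4\sqrt{n/l}\cdot\sigma_l(H)+0.5}\Big)$, then $$|||M-XY|||/\tilde\sigma_{r+1}(M)\le\sqrt{1+100\,\kappa^2(H)\,n/l}$$ with a probability no less than $1-\exp(-\frac{l-r}{20})-\exp(-\frac{n-r}{20})-\exp(-\frac n{72})$.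
   Context: All matrices are real. A Gaussian matrix is a matrix filled with independent standard normal random variables; a constant matrix is a non-random one. Events of probability $0$ are disregarded. $A^+$ denotes the Moore–Penrose pseudo inverse. $\sigma_j(A)$ is the $j$th largest singular value of $A$. $\kappa(H)=\|H\|_2\|H^+\|_2$ is the spectral condition number. $M_r$ denotes the rank-$r$ truncation of $M$ (set to $0$ all singular values $\sigma_j(M)$ with $j>r$ in an SVD of $M$), and $\tilde\sigma_{r+1}(M):=|||M-M_r|||$; thus $\tilde\sigma_{r+1}(M)=\sigma_{r+1}(M)$ for the spectral norm and $\tilde\sigma_{r+1}(M)^2=\sum_{j>r}\sigma_j(M)^2$ for the Frobenius norm. The ratio in the conclusion presupposes $\tilde\sigma_{r+1}(M)>0$. Column-sketching algorithm: given $M\in\mathbb R^{m\times n}$, a target rank $r$, and a sketch matrix $H\in\mathbb R^{n\times l}$ of full rank $l$ ($r\le l\le n$), fix a nonsingular $T\in\mathbb R^{l\times l}$ and output $X=MHT^{-1}\in\mathbb R^{m\times l}$ and $Y=\operatorname{argmin}_V|||XV-M|||=X^+M\in\mathbb R^{l\times n}$; the approximation to $M$ is $XY$. *)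

(* Defs.v *)
From HB Require Import structures.
From mathcomp Require Import all_boot all_order all_algebra.
From mathcomp Require Import all_classical all_reals all_analysis.

Set Implicit Arguments.
Unset Strict Implicit.
Unset Printing Implicit Defensive.

Import Order.TTheory GRing.Theory Num.Theory.
Import numFieldNormedType.Exports.

Local Open Scope classical_set_scope.
Local Open Scope ring_scope.

(* H^T H = I; for a square H this says that H is orthogonal. *)
Definition orthonormal_cols {R : realType} (n l : nat) (H : 'M[R]_(n, l)) :=
  H^T *m H = 1%:M.

Definition frob_norm {R : realType} (m n : nat) (A : 'M[R]_(m, n)) : R :=
  Num.sqrt (\sum_(i < m) \sum_(j < n) A i j ^+ 2).

(* On a column vector, frob_norm is the Euclidean norm. *)
Definition spec_norm {R : realType} (m n : nat) (A : 'M[R]_(m, n)) : R :=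
  sup [set frob_norm (A *m x) | x in [set x : 'cV[R]_n | frob_norm x <= 1]].

Inductive norm_kind := Spectral | Frobenius.

Definition mxnorm (N : norm_kind) {R : realType} (m n : nat)
    (A : 'M[R]_(m, n)) : R :=
  match N with Spectral => spec_norm A | Frobenius => frob_norm A end.

(* The rectangular m x n matrix with s 0, s 1, ... on its main diagonal. *)
Definition rect_diag {R : realType} (m n : nat) (s : nat -> R) : 'M[R]_(m, n) :=
  \matrix_(i < m, j < n) (if (i : nat) == j then s i else 0).

(* A = U S V^T is a full singular value decomposition. The diagonal s is
   0-based, and requiring it to vanish from index min(m, n) on makes it
   depend on A only. *)
Definition is_svd {R : realType} (m n : nat) (A : 'M[R]_(m, n))
    (U : 'M[R]_m) (s : nat -> R) (V : 'M[R]_n) : Prop :=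
  [/\ orthonormal_cols U, orthonormal_cols V,
      (forall i, 0 <= s i) /\ (forall i j, (i <= j)%N -> s j <= s i),
      forall i, (minn m n <= i)%N -> s i = 0
    & A = U *m rect_diag m n s *m V^T].

(* Some SVD of A; one always exists, so the default value is never used. *)
Definition svd {R : realType} (m n : nat) (A : 'M[R]_(m, n)) :
    'M[R]_m * (nat -> R) * 'M[R]_n :=
  xget (1%:M, (fun=> 0), 1%:M) [set t | is_svd A t.1.1 t.1.2 t.2].

(* sing_val A j is the j-th largest singular value of A, for j >= 1. *)
Definition sing_val {R : realType} (m n : nat) (A : 'M[R]_(m, n)) (j : nat) : R :=
  (svd A).1.2 j.-1.

Definition trunc_mx {R : realType} (m n : nat) (r : nat) (A : 'M[R]_(m, n)) :
    'M[R]_(m, n) :=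
  let: (U, s, V) := svd A in
  U *m rect_diag m n (fun i => if (i < r)%N then s i else 0) *m V^T.

(* tail_sv N r M is \tilde\sigma_{r+1}(M) := ||| M - M_r |||. *)
Definition tail_sv (N : norm_kind) {R : realType} (m n : nat) (r : nat)
    (M : 'M[R]_(m, n)) : R :=
  mxnorm N (M - trunc_mx r M).

Definition is_pinv {R : realType} (m n : nat) (A : 'M[R]_(m, n))
    (X : 'M[R]_(n, m)) : Prop :=
  [/\ A *m X *m A = A, X *m A *m X = X,
      (A *m X)^T = A *m X & (X *m A)^T = X *m A].

(* The Moore-Penrose pseudo inverse, i.e. the unique X with is_pinv A X.
   mxalgebra's pinvmx is only a one-sided partial inverse. *)
Definition mp_pinv {R : realType} (m n : nat) (A : 'M[R]_(m, n)) : 'M[R]_(n, m) :=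
  xget 0 [set X | is_pinv A X].

Definition cond_num {R : realType} (m n : nat) (H : 'M[R]_(m, n)) : R :=
  spec_norm H * spec_norm (mp_pinv H).

Definition sketch_X {R : realType} (m n l : nat) (M : 'M[R]_(m, n))
    (H : 'M[R]_(n, l)) (T : 'M[R]_l) : 'M[R]_(m, l) :=
  M *m H *m invmx T.

Definition sketch_Y {R : realType} (m n l : nat) (M : 'M[R]_(m, n))
    (X : 'M[R]_(m, l)) : 'M[R]_(l, n) :=
  mp_pinv X *m M.

Definition sketch_err (N : norm_kind) {R : realType} (m n l : nat)
    (M : 'M[R]_(m, n)) (H : 'M[R]_(n, l)) (T : 'M[R]_l) : R :=
  let X := sketch_X M H T in mxnorm N (M - X *m sketch_Y M X).

Definition mutually_independent {d : measure_display} {Omega : measurableType d}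
    {R : realType} (P : probability Omega R) (I : finType)
    (X : I -> {RV P >-> R}) : Prop :=
  forall (J : {set I}) (S : I -> set R),
    (forall i, measurable (S i)) ->
    P [set w | forall i, i \in J -> S i (X i w)] =
    (\prod_(i in J) P (X i @^-1` S i))%E.

Definition standard_normal {d : measure_display} {Omega : measurableType d}
    {R : realType} (P : probability Omega R) (X : {RV P >-> R}) : Prop :=
  forall S : set R, measurable S -> distribution P X S = normal_prob 0 1 S.

Definition gaussian_mx {d : measure_display} {Omega : measurableType d}
    {R : realType} (P : probability Omega R) (r n : nat)
    (G : 'I_r -> 'I_n -> {RV P >-> R}) : Prop :=
  mutually_independent (fun ij : 'I_r * 'I_n => G ij.1 ij.2) /\
  (forall i j, standard_normal (G i j)).

Definition random_mx {d : measure_display} {Omega : measurableType d}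
    {R : realType} (P : probability Omega R) (r n : nat)
    (G : 'I_r -> 'I_n -> {RV P >-> R}) (w : Omega) : 'M[R]_(r, n) :=
  \matrix_(i < r, j < n) G i j w.

(* Main.v *)
(** The error of the algorithm is at most [||| M - M H Z |||] for every [Z].  Let
[A^+] be the left inverse of [A], [C = B + A^+ E] and [F = E - A A^+ E], so that
[M = A C + F] with [A^T F = 0].  With [Z = (C H)^+ C] one gets
[M - M H Z = S (I - H Z)], where [S = F (I - P)] and [P] is the orthogonal
projection onto the row space of [C]; the norm of [I - H Z] on the relevant
subspaces is controlled by the extreme singular values of [C] and [C H].  On the
other hand [L M = A C + S] for some [L] close to the identity, and the
Eckart-Young argument for the orthogonal summands [A C] and [S] yields
[||| S ||| <= || L || ||| M - M_r |||].

As [C] is a scaled Gaussian matrix shifted by a constant, its smallest singular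
values are bounded after projecting the shift out, which costs [r] columns and
explains the exponents in [l - r] and [n - r].  For a fixed vector the tails come
from the Laplace transform of a Gaussian quadratic form, integrated one variable
at a time; a union bound over integer vectors, to which every direction is
rounded without increasing the quadratic form much, gives uniformity.

Only [||E||_F <= sigma_r(A) / 12] is needed for an [H] with orthonormal columns;
a full rank [H] has the same column space as one with orthonormal columns.

The events are measurable because the error and the tail are infima of families
of continuous functions of [M]; for the tail this needs the existence of the
singular value decomposition. *)

Require Import Defs.
From HB Require Import structures.
From mathcomp Require Import all_boot all_order all_algebra.
From mathcomp Require Import all_classical all_reals all_analysis.
From mathcomp Require Import ring lra zify measurable_realfun.

Set Implicit Arguments.
Unset Strict Implicit.
Unset Printing Implicit Defensive.

Import Order.TTheory GRing.Theory Num.Theory.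
Import numFieldNormedType.Exports.

Local Open Scope classical_set_scope.
Local Open Scope ring_scope.

(** * Norms *)

Section Frobenius.
Variable R : realType.
Implicit Types m n p : nat.

Definition ip {m n} (A B : 'M[R]_(m, n)) : R := \tr (A^T *m B).

(** Squared norms keep square roots out of most estimates; on a column this is the squared Euclidean
    norm. *)
Definition sqn {m n} (A : 'M[R]_(m, n)) : R := ip A A.

Lemma ipE m n (A B : 'M[R]_(m, n)) : ip A B = \sum_i \sum_j A i j * B i j.
Proof.
rewrite /ip /mxtrace exchange_big; apply: eq_bigr => i _ /=.
by rewrite mxE; apply: eq_bigr => j _; rewrite mxE.
Qed.

Lemma sqnE m n (A : 'M[R]_(m, n)) : sqn A = \sum_i \sum_j A i j ^+ 2.
Proof. by rewrite /sqn ipE; do 2!apply: eq_bigr => ? _; rewrite expr2. Qed.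

Lemma ipC m n (A B : 'M[R]_(m, n)) : ip A B = ip B A.
Proof. by rewrite !ipE; do 2!apply: eq_bigr => ? _; rewrite mulrC. Qed.

Lemma ip_tr m n (A B : 'M[R]_(m, n)) : ip A^T B^T = ip A B.
Proof. by rewrite /ip trmxK mxtrace_mulC -[LHS]mxtrace_tr trmx_mul trmxK. Qed.

Lemma ipDr m n (A B C : 'M[R]_(m, n)) : ip A (B + C) = ip A B + ip A C.
Proof. by rewrite /ip mulmxDr mxtraceD. Qed.

Lemma ipZr m n (a : R) (A B : 'M[R]_(m, n)) : ip A (a *: B) = a * ip A B.
Proof. by rewrite /ip -scalemxAr mxtraceZ. Qed.

Lemma ipDl m n (A B C : 'M[R]_(m, n)) : ip (B + C) A = ip B A + ip C A.
Proof. by rewrite ipC ipDr !(ipC A). Qed.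

Lemma ipZl m n (a : R) (A B : 'M[R]_(m, n)) : ip (a *: A) B = a * ip A B.
Proof. by rewrite ipC ipZr ipC. Qed.

Lemma ip_mull m n p (Y : 'M[R]_(m, n)) (A : 'M[R]_(n, p)) B :
  ip (Y *m A) B = ip A (Y^T *m B).
Proof. by rewrite /ip trmx_mul mulmxA. Qed.

Lemma sqn_ge0 m n (A : 'M[R]_(m, n)) : 0 <= sqn A.
Proof. by rewrite sqnE; do 2!apply: sumr_ge0 => ? _; rewrite sqr_ge0. Qed.

Lemma sqn0 m n : sqn (0 : 'M[R]_(m, n)) = 0.
Proof. by rewrite /sqn /ip mulmx0 mxtrace0. Qed.

Lemma sqn_eq0 m n (A : 'M[R]_(m, n)) : (sqn A == 0) = (A == 0).
Proof.
apply/eqP/eqP => [|->]; last exact: sqn0.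
rewrite sqnE => A0; apply/matrixP => i j; rewrite mxE.
have rows0 k : true -> 0 <= \sum_j A k j ^+ 2.
  by move=> _; apply: sumr_ge0 => ? _; rewrite sqr_ge0.
have /psumr_eq0P A2 := psumr_eq0P rows0 A0 (erefl : xpredT i).
by apply/eqP; rewrite -sqrf_eq0 A2// => k _; rewrite sqr_ge0.
Qed.

Lemma sqn_gt0 m n (A : 'M[R]_(m, n)) : (0 < sqn A) = (A != 0).
Proof. by rewrite lt_def sqn_ge0 andbT sqn_eq0. Qed.

Lemma sqnZ m n (a : R) (A : 'M[R]_(m, n)) : sqn (a *: A) = a ^+ 2 * sqn A.
Proof. by rewrite /sqn ipZr ipZl mulrA. Qed.

Lemma sqnN m n (A : 'M[R]_(m, n)) : sqn (- A) = sqn A.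
Proof. by rewrite -scaleN1r sqnZ sqrrN expr1n mul1r. Qed.

Lemma sqn_tr m n (A : 'M[R]_(m, n)) : sqn A^T = sqn A.
Proof. exact: ip_tr. Qed.

Lemma sqnD m n (A B : 'M[R]_(m, n)) :
  sqn (A + B) = sqn A + 2 * ip A B + sqn B.
Proof. rewrite /sqn ipDr !ipDl (ipC B A); ring. Qed.

Lemma sqnD_orth m n (A B : 'M[R]_(m, n)) :
  ip A B = 0 -> sqn (A + B) = sqn A + sqn B.
Proof. by rewrite sqnD => ->; rewrite mulr0 addr0. Qed.

(** Expanding the square of [|B|^2 A - <A, B> B] gives [|B|^2 (|A|^2 |B|^2 - <A, B>^2)]. *)
Lemma ip_cauchy m n (A B : 'M[R]_(m, n)) : ip A B ^+ 2 <= sqn A * sqn B.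
Proof.
have [->|B0] := eqVneq B 0.
  by rewrite sqn0 mulr0 /ip mulmx0 mxtrace0 expr0n.
have B1 : 0 < sqn B by rewrite sqn_gt0.
have := sqn_ge0 (sqn B *: A + (- ip A B) *: B).
rewrite sqnD !sqnZ ipZl ipZr.
set a := sqn A; set b := sqn B in B1 *; set c := ip A B.
have -> : b ^+ 2 * a + 2 * (b * (- c * c)) + (- c) ^+ 2 * b
  = b * (a * b - c ^+ 2) by ring.
by rewrite pmulr_rge0// subr_ge0.
Qed.

(** Cauchy-Schwarz bounds half the cross term by [sqrt (a x b y)], and twice that is at most
    [a y + b x]. With [a = x] and [b = y] this is the triangle inequality; with [a = 1], and with
    [x] and [y] the squared norms of two orthogonal parts of a vector, it yields the factor
    [1 + be^2 / al^2] of the residual bound. *)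
Lemma sqnD_weighted m n (A B : 'M[R]_(m, n)) (a b x y : R) :
  0 <= a -> 0 <= b -> 0 <= x -> 0 <= y ->
  sqn A <= a * x -> sqn B <= b * y -> sqn (A + B) <= (a + b) * (x + y).
Proof.
move=> a0 b0 x0 y0 hA hB; rewrite sqnD.
have h : 2 * ip A B <= a * y + b * x.
  have ab0 : 0 <= a * y + b * x by rewrite addr_ge0// mulr_ge0.
  apply: le_trans (ler_norm _) _; rewrite -(ger0_norm ab0).
  rewrite -ler_sqr ?nnegrE// !real_normK ?num_real// exprMn.
  have h1 := ip_cauchy A B.
  have h2 : sqn A * sqn B <= a * x * (b * y) by rewrite ler_pM ?sqn_ge0.
  have h3 := sqr_ge0 (a * y - b * x).
  nra.
by move: h hA hB; nra.
Qed.

Lemma frob_normE m n (A : 'M[R]_(m, n)) : frob_norm A = Num.sqrt (sqn A).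
Proof. by rewrite sqnE. Qed.

Lemma sqr_frob_norm m n (A : 'M[R]_(m, n)) : frob_norm A ^+ 2 = sqn A.
Proof. by rewrite frob_normE sqr_sqrtr// sqn_ge0. Qed.

Lemma frob_norm_ge0 m n (A : 'M[R]_(m, n)) : 0 <= frob_norm A.
Proof. exact: sqrtr_ge0. Qed.

Lemma frob_norm_le m n (A : 'M[R]_(m, n)) (c : R) :
  0 <= c -> (frob_norm A <= c) = (sqn A <= c ^+ 2).
Proof.
by move=> c0; rewrite -sqr_frob_norm ler_sqr// nnegrE ?frob_norm_ge0.
Qed.

(** The number [b] bounds the square of the operator norm. A predicate composes more directly with
    [sqn] than the supremum in [spec_norm]. *)
Definition opb {m n} (Y : 'M[R]_(m, n)) (b : R) :=
  forall x : 'cV[R]_n, sqn (Y *m x) <= b * sqn x.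

(** For [u = Y^T x] one has [|u|^4 = <Y u, x>^2 <= b |u|^2 |x|^2]; divide by [|u|^2]. *)
Lemma opb_tr m n (Y : 'M[R]_(m, n)) b : 0 <= b -> opb Y b -> opb Y^T b.
Proof.
move=> b0 Yb x; set u := Y^T *m x.
have [u0|u0] := eqVneq u 0; first by rewrite u0 sqn0 mulr_ge0// sqn_ge0.
have h : sqn u = ip (Y *m u) x by rewrite ip_mull.
have u1 : 0 < sqn u by rewrite sqn_gt0.
rewrite -(ler_pM2l u1) -expr2 {1}h (le_trans (ip_cauchy _ _))//.
rewrite (le_trans (ler_wpM2r (sqn_ge0 x) (Yb u)))//.
by rewrite mulrAC mulrA mulrC mulrA.
Qed.

Lemma sqn_cols m n (A : 'M[R]_(m, n)) : sqn A = \sum_j sqn (col j A).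
Proof.
rewrite sqnE exchange_big; apply: eq_bigr => j _; rewrite sqnE.
by apply: eq_bigr => i _; rewrite big_ord1 mxE.
Qed.

Lemma sqn_rows m n (A : 'M[R]_(m, n)) : sqn A = \sum_i sqn (row i A).
Proof.
rewrite -sqn_tr sqn_cols; apply: eq_bigr => i _.
by rewrite -tr_row sqn_tr.
Qed.

Lemma sqn_mull m n p (Y : 'M[R]_(m, n)) (A : 'M[R]_(n, p)) b :
  opb Y b -> sqn (Y *m A) <= b * sqn A.
Proof.
move=> Yb; rewrite !(sqn_cols (_ *m _)) (sqn_cols A) mulr_sumr.
by apply: ler_sum => j _; rewrite !colE -mulmxA.
Qed.

Lemma sqn_mulr m n p (A : 'M[R]_(m, n)) (Y : 'M[R]_(n, p)) b :
  0 <= b -> opb Y b -> sqn (A *m Y) <= b * sqn A.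
Proof.
move=> b0 Yb; rewrite -sqn_tr trmx_mul -(sqn_tr A).
by apply: sqn_mull; apply: opb_tr.
Qed.

Lemma opb_mul m n p (X : 'M[R]_(m, n)) (Y : 'M[R]_(n, p)) a b :
  0 <= a -> opb X a -> opb Y b -> opb (X *m Y) (a * b).
Proof.
move=> a0 Xa Yb x; rewrite -mulmxA (le_trans (Xa _))//.
by rewrite -mulrA ler_wpM2l.
Qed.

Lemma opb_frob m n (A : 'M[R]_(m, n)) : opb A (sqn A).
Proof.
move=> x; rewrite (sqn_rows (_ *m _)) (sqn_rows A) mulr_suml.
apply: ler_sum => i _; rewrite row_mul.
have -> : sqn (row i A *m x) = ip (row i A)^T x ^+ 2.
  by rewrite /ip trmxK sqnE !big_ord1 -trace_mx11.
by rewrite (le_trans (ip_cauchy _ _))// sqn_tr.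
Qed.

Lemma spec_set_has_sup m n (A : 'M[R]_(m, n)) :
  has_sup [set frob_norm (A *m x) | x in [set x : 'cV[R]_n | frob_norm x <= 1]].
Proof.
split; first by exists (frob_norm (A *m (0 : 'cV[R]_n))), 0; rewrite //= frob_normE sqn0 sqrtr0.
exists (frob_norm A) => _ [x /= x1 <-].
rewrite frob_norm_le ?frob_norm_ge0// sqr_frob_norm (le_trans (opb_frob _ _))//.
by rewrite ler_piMr ?sqn_ge0//; move: x1; rewrite frob_norm_le// expr1n.
Qed.

Lemma spec_norm_ge0 m n (A : 'M[R]_(m, n)) : 0 <= spec_norm A.
Proof.
have [_ ub] := spec_set_has_sup A.
rewrite (le_trans (frob_norm_ge0 (A *m (0 : 'cV[R]_n))))//; apply: ub_le_sup => //.
by exists 0; rewrite //= frob_normE sqn0 sqrtr0.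
Qed.

Lemma spec_norm_opb m n (A : 'M[R]_(m, n)) : opb A (spec_norm A ^+ 2).
Proof.
move=> x; have [->|x0] := eqVneq x 0; first by rewrite mulmx0 !sqn0 mulr0.
have [_ ub] := spec_set_has_sup A.
have fx : 0 < frob_norm x by rewrite frob_normE sqrtr_gt0 sqn_gt0.
have h : frob_norm (A *m ((frob_norm x)^-1 *: x)) <= spec_norm A.
  apply: ub_le_sup => //; exists ((frob_norm x)^-1 *: x) => //=.
  rewrite frob_norm_le// expr1n sqnZ exprVn sqr_frob_norm mulVf//.
  by rewrite sqn_eq0.
move: h; rewrite frob_norm_le ?spec_norm_ge0// -scalemxAr sqnZ exprVn.
by rewrite sqr_frob_norm mulrC ler_pdivrMr// sqn_gt0.
Qed.

Lemma spec_norm_le m n (A : 'M[R]_(m, n)) c :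
  0 <= c -> opb A (c ^+ 2) -> spec_norm A <= c.
Proof.
move=> c0 Ac; apply: ge_sup; first by case: (spec_set_has_sup A).
move=> _ [x /= x1 <-]; rewrite frob_norm_le// (le_trans (Ac x))//.
by rewrite ler_piMr ?sqr_ge0//; move: x1; rewrite frob_norm_le// expr1n.
Qed.

Lemma mxnorm_ge0 N m n (A : 'M[R]_(m, n)) : 0 <= mxnorm N A.
Proof. by case: N => /=; [exact: spec_norm_ge0|exact: frob_norm_ge0]. Qed.

Lemma mxnorm_le_frob N m n (A : 'M[R]_(m, n)) : mxnorm N A <= frob_norm A.
Proof.
case: N => //=; apply: spec_norm_le; first exact: frob_norm_ge0.
by rewrite sqr_frob_norm; exact: opb_frob.
Qed.

Lemma mxnorm_mull N m n p (Y : 'M[R]_(m, n)) (A : 'M[R]_(n, p)) c :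
  0 <= c -> opb Y (c ^+ 2) -> mxnorm N (Y *m A) <= c * mxnorm N A.
Proof.
move=> c0 Yc; have cA : 0 <= c * mxnorm N A by rewrite mulr_ge0 ?mxnorm_ge0.
case: N cA => /= cA.
  apply: spec_norm_le => //; rewrite exprMn.
  by apply: opb_mul; rewrite ?sqr_ge0//; exact: spec_norm_opb.
by rewrite frob_norm_le// exprMn sqr_frob_norm; exact: sqn_mull.
Qed.

Lemma mxnorm_mulr N m n p (A : 'M[R]_(m, n)) (Y : 'M[R]_(n, p)) c :
  0 <= c -> opb Y (c ^+ 2) -> mxnorm N (A *m Y) <= c * mxnorm N A.
Proof.
move=> c0 Yc; have cA : 0 <= c * mxnorm N A by rewrite mulr_ge0 ?mxnorm_ge0.
case: N cA => /= cA.
  apply: spec_norm_le => //; rewrite exprMn mulrC.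
  by apply: opb_mul; rewrite ?sqr_ge0//; exact: spec_norm_opb.
by rewrite frob_norm_le// exprMn sqr_frob_norm; apply: sqn_mulr; rewrite ?sqr_ge0.
Qed.

Lemma frob_normD m n (A B : 'M[R]_(m, n)) :
  frob_norm (A + B) <= frob_norm A + frob_norm B.
Proof.
have AB0 : 0 <= frob_norm A + frob_norm B by rewrite addr_ge0 ?frob_norm_ge0.
rewrite frob_norm_le// expr2.
apply: sqnD_weighted; rewrite ?frob_norm_ge0//.
  by rewrite -expr2 sqr_frob_norm.
by rewrite -expr2 sqr_frob_norm.
Qed.

Lemma mxnormD N m n (A B : 'M[R]_(m, n)) :
  mxnorm N (A + B) <= mxnorm N A + mxnorm N B.
Proof.
case: N => /=; last exact: frob_normD.
apply: spec_norm_le => [|x]; first by rewrite addr_ge0 ?spec_norm_ge0.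
have := frob_normD (A *m x) (B *m x); rewrite -mulmxDl => h.
have fb (C : 'M[R]_(m, n)) : frob_norm (C *m x) <= spec_norm C * frob_norm x.
  rewrite frob_norm_le ?mulr_ge0 ?spec_norm_ge0 ?frob_norm_ge0//.
  by rewrite exprMn sqr_frob_norm; exact: spec_norm_opb.
rewrite -(sqr_frob_norm x) -exprMn -frob_norm_le; last first.
  by rewrite mulr_ge0 ?addr_ge0 ?spec_norm_ge0 ?frob_norm_ge0.
by rewrite mulrDl (le_trans h)// lerD.
Qed.

End Frobenius.

(** * Pseudo inverses, orthogonal projections and the optimality of the sketch *)

Section PseudoInverse.
Variable R : realType.
Implicit Types m n p r l : nat.

(** For [C] of full row rank this is the Moore-Penrose inverse, and [rowproj C] is the orthogonal
    projection onto the row space of [C]. *)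
Definition rinv {r n} (C : 'M[R]_(r, n)) : 'M[R]_(n, r) :=
  C^T *m invmx (C *m C^T).

Definition rowproj {r n} (C : 'M[R]_(r, n)) : 'M[R]_n := rinv C *m C.

Lemma gram_unitmx r n (C : 'M[R]_(r, n)) :
  row_free C -> C *m C^T \in unitmx.
Proof.
move=> Cfree; rewrite -row_free_unit -kermx_eq0; apply/eqP/row_matrixP => i.
rewrite row0; set u := row i _.
have : u *m (C *m C^T) = 0 by apply/sub_kermxP; exact: row_sub.
move=> /(congr1 (fun v => \tr (v *m u^T))); rewrite mul0mx mxtrace0.
rewrite mulmxA -(mulmxA _ C^T) -trmx_mul.
have <- : sqn (u *m C)^T = \tr (u *m C *m (u *m C)^T) by rewrite /sqn /ip trmxK.
move/eqP; rewrite sqn_eq0 => /eqP/(congr1 trmx); rewrite trmxK trmx0 => uC0.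
by apply: (row_free_inj Cfree); rewrite uC0 mul0mx.
Qed.

Lemma mul_rinv r n (C : 'M[R]_(r, n)) : row_free C -> C *m rinv C = 1%:M.
Proof. by move=> Cf; rewrite /rinv mulmxA mulmxV// gram_unitmx. Qed.

Lemma gram_inv_sym r n (C : 'M[R]_(r, n)) :
  (invmx (C *m C^T))^T = invmx (C *m C^T).
Proof. by rewrite trmx_inv trmx_mul trmxK. Qed.

Lemma rowproj_sym r n (C : 'M[R]_(r, n)) : (rowproj C)^T = rowproj C.
Proof. by rewrite /rowproj /rinv !trmx_mul trmxK gram_inv_sym mulmxA. Qed.

Lemma mul_rowproj r n (C : 'M[R]_(r, n)) : row_free C -> C *m rowproj C = C.
Proof. by move=> Cf; rewrite /rowproj mulmxA mul_rinv// mul1mx. Qed.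

Lemma rowproj_idem r n (C : 'M[R]_(r, n)) :
  row_free C -> rowproj C *m rowproj C = rowproj C.
Proof. by move=> Cf; rewrite {1}/rowproj -mulmxA mul_rowproj. Qed.

Lemma rowproj_tr_mul r n (C : 'M[R]_(r, n)) :
  row_free C -> rowproj C *m C^T = C^T.
Proof.
by move=> Cf; rewrite -[in LHS]rowproj_sym -trmx_mul mul_rowproj.
Qed.

Lemma rowproj_rinv r n (C : 'M[R]_(r, n)) :
  row_free C -> rowproj C *m rinv C = rinv C.
Proof. by move=> Cf; rewrite /rinv mulmxA rowproj_tr_mul. Qed.

Lemma mxtrace_rowproj r n (C : 'M[R]_(r, n)) :
  row_free C -> \tr (rowproj C) = r%:R.
Proof. by move=> Cf; rewrite mxtrace_mulC mul_rinv// mxtrace1. Qed.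

Section SymIdempotent.
Variables (n : nat) (Q : 'M[R]_n).
Hypotheses (Qsym : Q^T = Q) (Qidem : Q *m Q = Q).

Lemma sqn_proj_split p (A : 'M[R]_(n, p)) :
  sqn A = sqn (Q *m A) + sqn ((1%:M - Q) *m A).
Proof.
rewrite -sqnD_orth; first by rewrite mulmxBl mul1mx addrC subrK.
rewrite ip_mull Qsym mulmxA mulmxBr mulmx1 Qidem subrr mul0mx.
by rewrite /ip mulmx0 mxtrace0.
Qed.

Lemma opb_coproj : opb (1%:M - Q) 1.
Proof. by move=> x; rewrite mul1r [leRHS]sqn_proj_split lerDr sqn_ge0. Qed.

Lemma coproj_sym : (1%:M - Q)^T = 1%:M - Q.
Proof. by rewrite linearB /= trmx1 Qsym. Qed.

Lemma coproj_idem : (1%:M - Q) *m (1%:M - Q) = 1%:M - Q.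
Proof.
by rewrite mulmxBr mulmx1 mulmxBl mul1mx Qidem subrr subr0.
Qed.

Lemma sqn_projr_split p (A : 'M[R]_(p, n)) :
  sqn A = sqn (A *m Q) + sqn (A *m (1%:M - Q)).
Proof.
rewrite -sqn_tr sqn_proj_split.
by congr (_ + _); rewrite -[RHS]sqn_tr trmx_mul ?coproj_sym ?Qsym.
Qed.

Lemma sqn_proj : sqn Q = \tr Q.
Proof. by rewrite /sqn /ip Qsym Qidem. Qed.

End SymIdempotent.

(** A lower bound on the square of the [r]-th singular value, stated through [C^T] so that a
    positive [a] forces full row rank. *)
Definition lob {r n} (C : 'M[R]_(r, n)) (a : R) :=
  forall x : 'cV[R]_r, a * sqn x <= sqn (C^T *m x).

Lemma lob_row_free r n (C : 'M[R]_(r, n)) a : 0 < a -> lob C a -> row_free C.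
Proof.
move=> a0 Ca; rewrite -kermx_eq0; apply/eqP/row_matrixP => i.
rewrite row0; set u := row i _.
have uC : u *m C = 0 by apply/sub_kermxP; exact: row_sub.
have := Ca u^T; rewrite -trmx_mul uC trmx0 sqn0 pmulr_rle0// sqn_tr => u0.
by apply/eqP; rewrite -sqn_eq0 eq_le u0 sqn_ge0.
Qed.

(** Let [w = (C C^T)^-1 y] and [t = |C^T w|^2 = <w, y>]. Then [a |w|^2 <= t] and
    [t^2 <= |w|^2 |y|^2] give [a t <= |y|^2]. *)
Lemma opb_rinv r n (C : 'M[R]_(r, n)) a : 0 < a -> lob C a -> opb (rinv C) a^-1.
Proof.
move=> a0 Ca y; have Cf := lob_row_free a0 Ca.
rewrite /rinv -mulmxA; set w := invmx _ *m y.
have hy : y = C *m C^T *m w by rewrite /w mulmxA mulmxV ?gram_unitmx// mul1mx.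
have h1 : sqn (C^T *m w) = ip w y by rewrite hy /sqn ip_mull trmxK mulmxA.
have h2 := Ca w; have h3 := ip_cauchy w y; rewrite -h1 in h3.
rewrite ler_pdivlMl//.
set t := sqn (C^T *m w) in h2 h3 *; have t0 : 0 <= t by exact: sqn_ge0.
have [->|tn0] := eqVneq t 0; first by rewrite mulr0 sqn_ge0.
have tp : 0 < t by rewrite lt_def tn0.
have h4 : a * t ^+ 2 <= t * sqn y.
  rewrite (le_trans (ler_wpM2l (ltW a0) h3))// mulrA ler_wpM2r ?sqn_ge0//.
by rewrite -(ler_pM2l tp); move: h4; rewrite expr2 mulrCA.
Qed.

(** From a full rank factorization [A = c b], the product [b^+ c^+] is the pseudo inverse, both
    factors being given by [rinv]. *)
Lemma is_pinv_ex m n (A : 'M[R]_(m, n)) : exists X, is_pinv A X.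
Proof.
have [k [c [b [Acb bf cf]]]] : exists k (c : 'M[R]_(m, k)) (b : 'M[R]_(k, n)),
    [/\ A = c *m b, row_free b & row_free c^T].
  exists (\rank A), (col_base A), (row_base A).
  rewrite mulmx_base row_base_free; split=> //.
  by rewrite /row_free mxrank_tr; have := col_base_full A; rewrite /row_full.
have lc : (rinv c^T)^T *m c = 1%:M.
  by apply: trmx_inj; rewrite trmx_mul trmxK mul_rinv// trmx1.
exists (rinv b *m (rinv c^T)^T).
have AX : A *m (rinv b *m (rinv c^T)^T) = rowproj c^T.
  rewrite Acb mulmxA -(mulmxA c) mul_rinv// mulmx1.
  by rewrite -[RHS]rowproj_sym /rowproj [RHS]trmx_mul trmxK.
have XA : rinv b *m (rinv c^T)^T *m A = rowproj b.
  by rewrite Acb mulmxA -(mulmxA (rinv b)) lc mulmx1.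
split.
- by rewrite -mulmxA XA Acb -mulmxA mul_rowproj.
- by rewrite XA mulmxA rowproj_rinv.
- by rewrite AX rowproj_sym.
- by rewrite XA rowproj_sym.
Qed.

Lemma mp_pinvP m n (A : 'M[R]_(m, n)) : is_pinv A (mp_pinv A).
Proof.
rewrite /mp_pinv; have [X hX] := is_pinv_ex A.
exact: (@xgetPex _ 0 [set X | is_pinv A X] (ex_intro _ X hX)).
Qed.

(** Full column rank makes [H^+ H] the identity, whose norm is 1 as [l > 0], and the spectral norm
    is submultiplicative. *)
Lemma cond_num_ge1 n l (H : 'M[R]_(n, l)) :
  (0 < l)%N -> \rank H = l -> 1 <= cond_num H.
Proof.
move=> l0 Hr; have [HXH _ _ _] := mp_pinvP H.
have XH1 : mp_pinv H *m H = 1%:M.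
  have HT : row_free H^T by rewrite /row_free mxrank_tr Hr.
  apply: trmx_inj; apply: (row_free_inj HT); rewrite -!trmx_mul mulmxA HXH.
  by rewrite mulmx1.
have hb : opb (1%:M : 'M[R]_l) (cond_num H ^+ 2).
  rewrite -XH1 /cond_num mulrC exprMn.
  by apply: opb_mul; [exact: sqr_ge0|exact: spec_norm_opb|exact: spec_norm_opb].
have := hb (const_mx 1); rewrite mul1mx -[leLHS]mul1r ler_pM2r; last first.
  rewrite sqn_gt0; apply/eqP => /matrixP /(_ (Ordinal l0) ord0).
  by rewrite !mxE; apply/eqP; rewrite oner_eq0.
rewrite -[X in X <= _](expr1n _ 2) ler_sqr// ?nnegrE ?ler01//.
by rewrite mulr_ge0 ?spec_norm_ge0.
Qed.

(** Since [M H Z = X (T Z)] is annihilated by [I - X X^+], the residual [M - X X^+ M] equals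
    [(I - X X^+) (M - M H Z)], and an orthogonal projection increases neither norm. *)
Lemma sketch_err_le N m n l (M : 'M[R]_(m, n)) (H : 'M[R]_(n, l)) (T : 'M[R]_l)
    (Z : 'M[R]_(l, n)) : T \in unitmx ->
  sketch_err N M H T <= mxnorm N (M - M *m H *m Z).
Proof.
move=> Tu; rewrite /sketch_err /sketch_Y; set X := sketch_X M H T.
have [XYX YXY XYs _] := mp_pinvP X; set Y := mp_pinv X in XYX YXY XYs *.
have -> : M - X *m (Y *m M) = (1%:M - X *m Y) *m (M - M *m H *m Z).
  have MHZ : M *m H *m Z = X *m (T *m Z) by rewrite /X /sketch_X mulmxA mulmxKV.
  have kX : (1%:M - X *m Y) *m X = 0 by rewrite mulmxBl mul1mx XYX subrr.
  rewrite mulmxBr MHZ (mulmxA _ X) kX mul0mx subr0.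
  by rewrite mulmxBl mul1mx mulmxA.
rewrite -[leRHS]mul1r; apply: mxnorm_mull => //.
by rewrite expr1n; apply: opb_coproj => //; rewrite mulmxA XYX.
Qed.

(** The bound of [sketch_err_le] is attained, so the error is a minimum over [Z]; semicontinuity in
    [M] will follow from this. *)
Lemma sketch_err_eq N m n l (M : 'M[R]_(m, n)) (H : 'M[R]_(n, l)) (T : 'M[R]_l) :
  T \in unitmx ->
  sketch_err N M H T = mxnorm N (M - M *m H *m (invmx T *m sketch_Y M (sketch_X M H T))).
Proof. by move=> Tu; rewrite /sketch_err /sketch_X !mulmxA. Qed.

End PseudoInverse.

(** * The Eckart-Young argument for two orthogonal summands *)

Section EckartYoung.
Variables (R : realType) (m n r : nat).
Variables (N1 N2 Z : 'M[R]_(m, n)) (C : 'M[R]_(r, n)) (s : R).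
Hypotheses (s0 : 0 <= s) (Cf : row_free C).
Hypothesis N12 : N1^T *m N2 = 0.
(** The level [s] separates [N1] from [N2] as it would separate the head of a singular value
    decomposition from its tail, without reference to singular vectors. *)
Hypothesis N1lb : forall x : 'cV_n, s * sqn (rowproj C *m x) <= sqn (N1 *m x).
Hypothesis N2ub :
  forall x : 'cV_n, sqn (N2 *m x) <= s * sqn ((1%:M - rowproj C) *m x).
Hypothesis Zr : (\rank Z <= r)%N.

Let P := rowproj C.
Let Psym : P^T = P. Proof. exact: rowproj_sym. Qed.
Let Pidem : P *m P = P. Proof. exact: rowproj_idem. Qed.

Let sqnN12 p (A : 'M[R]_(n, p)) :
  sqn ((N1 + N2) *m A) = sqn (N1 *m A) + sqn (N2 *m A).
Proof.
rewrite mulmxDl sqnD_orth// ip_mull mulmxA N12 mul0mx.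
by rewrite /ip mulmx0 mxtrace0.
Qed.

Let N2P0 : N2 *m P = 0.
Proof.
apply/eqP; rewrite -sqn_eq0 eq_le sqn_ge0 andbT sqn_cols.
rewrite big1// => j _; apply/eqP; rewrite eq_le sqn_ge0 andbT.
rewrite colE -mulmxA (le_trans (N2ub _))// mulmxA mulmxBl mul1mx Pidem subrr.
by rewrite mul0mx sqn0 mulr0.
Qed.

Let N2coP : N2 *m (1%:M - P) = N2.
Proof. by rewrite mulmxBr mulmx1 N2P0 subr0. Qed.

(** Let [Q] project onto the row space of [Z]. Multiplying by [I - Q] removes [Z], so it suffices
    that [|N2 Q|^2 <= |N1 (I - Q)|^2]. Through [s] this reduces to [|(I - P) Q|^2 <= |P (I - Q)|^2],
    which holds because [tr Q <= r = tr P]. *)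
Lemma eckart_young_frob : sqn N2 <= sqn (N1 + N2 - Z).
Proof.
set b := row_base Z; have bf : row_free b by exact: row_base_free.
set Q := rowproj b.
have Qsym : Q^T = Q by exact: rowproj_sym.
have Qidem : Q *m Q = Q by exact: rowproj_idem.
have ZQ : Z *m Q = Z by rewrite -(mulmx_base Z) -mulmxA mul_rowproj.
have coQ := coproj_idem Qidem; have coQs := coproj_sym Qsym.
have h1 : sqn ((N1 + N2 - Z) *m (1%:M - Q)) <= sqn (N1 + N2 - Z).
  by rewrite -[leRHS]mul1r; apply: sqn_mulr => //; exact: opb_coproj.
apply: le_trans h1.
have -> : (N1 + N2 - Z) *m (1%:M - Q) = (N1 + N2) *m (1%:M - Q).
  by rewrite mulmxBl [X in _ - X]mulmxBr mulmx1 ZQ subrr subr0.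
rewrite sqnN12.
have split2 : sqn N2 = sqn (N2 *m Q) + sqn (N2 *m (1%:M - Q)).
  exact: sqn_projr_split.
have lb : s * sqn (P *m (1%:M - Q)) <= sqn (N1 *m (1%:M - Q)).
  rewrite (sqn_cols (P *m _)) (sqn_cols (N1 *m _)) mulr_sumr.
  by apply: ler_sum => j _; rewrite !colE -(mulmxA P) -(mulmxA N1); exact: N1lb.
have ub : sqn (N2 *m Q) <= s * sqn ((1%:M - P) *m Q).
  rewrite (sqn_cols (N2 *m _)) (sqn_cols (_ *m Q)) mulr_sumr.
  by apply: ler_sum => j _; rewrite !colE -(mulmxA N2) -(mulmxA (_ - _)); exact: N2ub.
have trP : sqn P = r%:R by rewrite sqn_proj// mxtrace_rowproj.
have trQ : sqn Q = (\rank Z)%:R by rewrite sqn_proj// mxtrace_rowproj.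
have e1 : sqn P = sqn (P *m Q) + sqn (P *m (1%:M - Q)).
  exact: sqn_projr_split.
have e2 := sqn_proj_split Psym Pidem Q.
have le_sqn : sqn ((1%:M - P) *m Q) <= sqn (P *m (1%:M - Q)).
  have : sqn Q <= sqn P by rewrite trP trQ ler_nat.
  rewrite e1 e2; lra.
rewrite split2 lerD2r; apply: le_trans ub (le_trans _ lb).
by rewrite ler_wpM2l.
Qed.

(* For y orthogonal to the row space of C, that space plus y has dimension
   r + 1 and thus meets the kernel of Z. *)
Lemma eckart_young_spec : spec_norm N2 <= spec_norm (N1 + N2 - Z).
Proof.
set nu := spec_norm (N1 + N2 - Z).
apply: spec_norm_le => [|x]; first exact: spec_norm_ge0.
set y := (1%:M - P) *m x.
have N2y : N2 *m y = N2 *m x by rewrite /y mulmxA N2coP.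
have yx : sqn y <= sqn x.
  by rewrite -[leRHS]mul1r; exact: opb_coproj.
have [y0|yn0] := eqVneq y 0.
  by rewrite -N2y y0 mulmx0 sqn0 mulr_ge0 ?sqr_ge0 ?sqn_ge0.
suff h : sqn (N2 *m y) <= nu ^+ 2 * sqn y.
  by rewrite -N2y (le_trans h)// ler_wpM2l ?sqr_ge0.
have Cy : C *m y = 0.
  by rewrite /y mulmxA mulmxBr mulmx1 mul_rowproj// subrr mul0mx.
have Py : P *m y = 0 by rewrite /P /rowproj -mulmxA Cy mulmx0.
have coPy : (1%:M - P) *m y = y by rewrite mulmxBl Py mul1mx subr0.
have sy : sqn (N2 *m y) <= s * sqn y by have := N2ub y; rewrite coPy.
rewrite leNgt; apply/negP => hlt.
set D := col_mx C y^T.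
have [w wn0 wZ] : exists2 w : 'rV[R]_(r + 1), w != 0 & w *m D *m Z^T = 0.
  have rk : (\rank (D *m Z^T) < r + 1)%N.
    rewrite (leq_ltn_trans (mxrankM_maxr _ _))// mxrank_tr addn1 ltnS.
    exact: Zr.
  have /rowV0Pn[v /sub_kermxP vk vn0] : kermx (D *m Z^T) != 0.
    by rewrite kermx_eq0 /row_free neq_ltn rk.
  by exists v => //; rewrite -mulmxA.
set c := (lsubmx w *m C)^T; set t := rsubmx w ord0 ord0.
have vE : (w *m D)^T = c + t *: y.
  rewrite -{1}[w]hsubmxK mul_row_col linearD /= [rsubmx w]mx11_scalar -/t.
  by rewrite mul_scalar_mx [X in _ + X]linearZ /= trmxK.
have Pc : P *m c = c by rewrite /c trmx_mul mulmxA rowproj_tr_mul.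
have Zv : Z *m (c + t *: y) = 0.
  by rewrite -vE -[Z]trmxK -trmx_mul wZ trmx0.
have Pv : P *m (c + t *: y) = c.
  by rewrite mulmxDr -scalemxAr Pc Py scaler0 addr0.
have N2v : N2 *m (c + t *: y) = t *: (N2 *m y).
  by rewrite mulmxDr -scalemxAr -Pc mulmxA N2P0 mul0mx add0r.
have cy : sqn (c + t *: y) = sqn c + t ^+ 2 * sqn y.
  by rewrite sqnD_orth ?sqnZ// ipZr -Pc ip_mull Psym Py /ip mulmx0 mxtrace0 mulr0.
(* On this vector [Z] vanishes, [P] sees only [c] and [N2] sees only [t y]. *)
have key : s * sqn c + t ^+ 2 * sqn (N2 *m y)
    <= nu ^+ 2 * (sqn c + t ^+ 2 * sqn y).
  rewrite -cy; apply: le_trans (spec_norm_opb _ _).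
  rewrite mulmxBl Zv subr0 sqnN12 N2v sqnZ lerD2r.
  by rewrite -{1}Pv.
have nus : nu ^+ 2 < s.
  by rewrite -(ltr_pM2r (_ : 0 < sqn y)) ?sqn_gt0//; exact: lt_le_trans hlt sy.
(* As [nu^2 < s], the inequality [key] fails in both cases; when [t = 0], the vector [c] is nonzero
   because [w] is. *)
have [t0|tn0] := eqVneq t 0.
  have cn0 : c != 0.
    apply: contra wn0 => /eqP c0.
    have l0 : lsubmx w = 0.
      apply: (row_free_inj Cf); rewrite mul0mx.
      by apply: trmx_inj; rewrite trmx0.
    have r0 : rsubmx w = 0.
      by rewrite [rsubmx w]mx11_scalar -/t t0; apply/matrixP => ? ?; rewrite !mxE mul0rn.
    by rewrite -[w]hsubmxK l0 r0 row_mx0.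
  move: key; rewrite t0 expr0n /= !mul0r !addr0 ler_pM2r ?sqn_gt0//.
  by rewrite leNgt nus.
have h1 : nu ^+ 2 * sqn c <= s * sqn c by rewrite ler_wpM2r ?sqn_ge0// ltW.
have h2 : t ^+ 2 * (nu ^+ 2 * sqn y) < t ^+ 2 * sqn (N2 *m y).
  by rewrite ltr_pM2l// exprn_even_gt0.
move: key h1 h2; rewrite mulrDr (mulrCA (nu ^+ 2)); lra.
Qed.

Lemma eckart_young N : mxnorm N N2 <= mxnorm N (N1 + N2 - Z).
Proof.
case: N => /=; first exact: eckart_young_spec.
by rewrite frob_norm_le ?frob_norm_ge0// sqr_frob_norm; exact: eckart_young_frob.
Qed.

End EckartYoung.

(** * The error bound for fixed matrices *)

Section DeterministicBound.
Variables (R : realType) (N : norm_kind) (m n r l : nat).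
Variables (A : 'M[R]_(m, r)) (C : 'M[R]_(r, n)) (F : 'M[R]_(m, n)).
Variables (H : 'M[R]_(n, l)) (T : 'M[R]_l) (Z : 'M[R]_(m, n)).
Variables (sigma eps al be ga : R).
Hypotheses (sigma0 : 0 < sigma) (eps0 : 0 <= eps) (al0 : 0 < al).
Hypotheses (ga0 : 0 < ga) (epsga : eps <= sigma * ga).
Hypotheses (Tu : T \in unitmx) (Hort : orthonormal_cols H).
Hypotheses (Asig : lob A^T (sigma ^+ 2)) (AF : A^T *m F = 0).
Hypotheses (Feps : opb F (eps ^+ 2)) (Cga : lob C (ga ^+ 2)).
Hypotheses (Cbe : opb C^T (be ^+ 2)) (CHal : lob (C *m H) (al ^+ 2)).
Hypothesis (Zr : (\rank Z <= r)%N).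

Let M := A *m C + F.
Let P := rowproj C.
Let S := F *m (1%:M - P).

Let Cf : row_free C.
Proof. by apply: lob_row_free Cga; rewrite exprn_gt0. Qed.

Let Af : row_free A^T.
Proof. by apply: lob_row_free Asig; rewrite exprn_gt0. Qed.

Let Psym : P^T = P. Proof. exact: rowproj_sym. Qed.
Let Pidem : P *m P = P. Proof. exact: rowproj_idem. Qed.

(** The factor [K] maps [x] to [(I - P) x - H Y P x]. As [H] is an isometry and [Y = (C H)^+ C], the
    second term is at most [be / al] times [|P x|], and the two parts of [x] are orthogonal. *)
Lemma sketch_err_le_residual :
  sketch_err N M H T <= Num.sqrt (1 + be ^+ 2 / al ^+ 2) * mxnorm N S.
Proof.
have al2 : 0 < al ^+ 2 by rewrite exprn_gt0.
have CHf : row_free (C *m H) by apply: lob_row_free CHal.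
set Y := rinv (C *m H) *m C.
apply: le_trans (sketch_err_le N M H Y Tu) _.
have CHY : C *m H *m Y = C by rewrite /Y mulmxA mul_rinv// mul1mx.
set K := 1%:M - P - H *m Y.
have -> : M - M *m H *m Y = S *m K.
  have PHY : P *m (H *m Y) = P by rewrite /P /rowproj -mulmxA (mulmxA C) CHY.
  have -> : M - M *m H *m Y = F - F *m (H *m Y).
    rewrite /M !mulmxDl -!(mulmxA A) CHY -(mulmxA F) opprD addrACA subrr.
    by rewrite add0r.
  rewrite /S /K -mulmxA [(1%:M - P) *m _]mulmxBr coproj_idem//.
  rewrite [(1%:M - P) *m (H *m Y)]mulmxBl mul1mx PHY opprB addrA.
  by rewrite subrK mulmxBr mulmx1.
have be1 : 0 <= be ^+ 2 / al ^+ 2 by rewrite divr_ge0 ?sqr_ge0.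
apply: mxnorm_mulr; first exact: sqrtr_ge0.
rewrite sqr_sqrtr; last by rewrite addr_ge0.
move=> x.
have -> : sqn x = sqn ((1%:M - P) *m x) + sqn (P *m x).
  by rewrite [RHS]addrC -sqn_proj_split.
have -> : K *m x = (1%:M - P) *m x + - (H *m Y *m (P *m x)).
  have YP : Y *m P = Y by rewrite /Y -mulmxA mul_rowproj.
  by rewrite /K mulmxBl -[in RHS](mulmxA H Y) (mulmxA Y) YP mulmxA.
apply: sqnD_weighted; rewrite ?sqn_ge0 ?mul1r//.
rewrite sqnN -(mulmxA H Y) /sqn ip_mull (mulmxA H^T) Hort mul1mx.
rewrite -/(sqn _) /Y [be ^+ 2 / _]mulrC.
have opbC : opb C (be ^+ 2).
  by rewrite -[C]trmxK; apply: opb_tr; first exact: sqr_ge0.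
apply: (opb_mul _ (opb_rinv al2 CHal) opbC).
by rewrite invr_ge0 ltW.
Qed.

(** With [L = I - F C^+ A^+], the relations [A^+ A = I] and [A^+ F = 0] give
    [L M = A C + F - F C^+ C = A C + S]. Eckart-Young is applied to [L M] with the competitor [L Z],
    still of rank at most [r]; the assumption [eps <= sigma ga] provides the separating level
    [(sigma ga)^2]. *)
Lemma residual_le_tail :
  mxnorm N S <= (1 + eps / (sigma * ga)) * mxnorm N (M - Z).
Proof.
have sg0 : 0 < sigma * ga by rewrite mulr_gt0.
set Ap := (rinv A^T)^T.
have ApA : Ap *m A = 1%:M by apply: trmx_inj; rewrite trmx_mul trmxK mul_rinv// trmx1.
have ApF : Ap *m F = 0.
  rewrite /Ap /rinv trmx_mul trmxK -mulmxA AF.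
  by rewrite mulmx0.
set L := 1%:M - F *m rinv C *m Ap.
have LM : L *m M = A *m C + S.
  rewrite mulmxBl mul1mx -[F *m rinv C *m Ap *m M]mulmxA /M mulmxDr mulmxA ApA.
  by rewrite mul1mx ApF addr0 /S mulmxBr mulmx1 -(mulmxA F (rinv C) C) addrA.
have Sx x : S *m x = S *m ((1%:M - P) *m x).
  by rewrite /S -!mulmxA (mulmxA (1%:M - P)) coproj_idem.
have h1 : mxnorm N S <= mxnorm N (A *m C + S - L *m Z).
  apply: (@eckart_young R m n r (A *m C) S (L *m Z) C ((sigma * ga) ^+ 2)) => //.
  - exact: sqr_ge0.
  - by rewrite trmx_mul -mulmxA /S (mulmxA A^T) AF mul0mx mulmx0.
  - move=> x; rewrite -mulmxA exprMn -mulrA.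
    have := Asig (C *m x); rewrite trmxK; apply: le_trans.
    rewrite ler_wpM2l ?sqr_ge0// mulrC -ler_pdivlMr ?exprn_gt0// mulrC.
    by rewrite -mulmxA; apply: opb_rinv; rewrite ?exprn_gt0.
  - move=> x; rewrite /S -mulmxA (le_trans (Feps _))// ler_wpM2r ?sqn_ge0//.
    by rewrite ler_sqr ?nnegrE// ltW.
  - by rewrite (leq_trans (mxrankM_maxr _ _)).
apply: le_trans h1 _; rewrite -LM -mulmxBr.
have e0 : 0 <= eps / (sigma * ga) by rewrite divr_ge0// ltW.
apply: mxnorm_mull; first by rewrite addr_ge0.
move=> x; rewrite mulmxBl mul1mx.
have hx : 0 <= frob_norm x by exact: frob_norm_ge0.
rewrite -sqr_frob_norm -(sqr_frob_norm x) -exprMn ler_sqr ?nnegrE ?frob_norm_ge0//;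
  last by rewrite mulr_ge0// addr_ge0.
rewrite (le_trans (frob_normD _ _))// mulrDl mul1r lerD2l.
rewrite frob_norm_le ?(mulr_ge0 e0)// sqnN exprMn sqr_frob_norm.
have -> : (eps / (sigma * ga)) ^+ 2 = eps ^+ 2 * (ga ^+ 2)^-1 * (sigma ^+ 2)^-1.
  by rewrite expr_div_n exprMn invfM mulrA mulrAC.
apply: opb_mul.
- by rewrite mulr_ge0// ?invr_ge0 sqr_ge0.
- by apply: opb_mul; rewrite ?sqr_ge0//; apply: opb_rinv; rewrite ?exprn_gt0.
- by apply: opb_tr; rewrite ?invr_ge0 ?sqr_ge0//; apply: opb_rinv; rewrite ?exprn_gt0.
Qed.

Lemma sketch_err_le_tail :
  sketch_err N M H T <=
  Num.sqrt (1 + be ^+ 2 / al ^+ 2) * (1 + eps / (sigma * ga)) * mxnorm N (M - Z).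
Proof.
apply: le_trans sketch_err_le_residual _; rewrite -mulrA.
by rewrite ler_wpM2l ?sqrtr_ge0// residual_le_tail.
Qed.

End DeterministicBound.

(** * Singular value decomposition *)

Section SingularValues.
Variable R : realType.
Implicit Types m n : nat.

Lemma continuous_sum (S : topologicalType) (I : Type) (s : seq I)
    (f : I -> S -> R) :
  (forall i, continuous (f i)) -> continuous (fun x => \sum_(i <- s) f i x).
Proof.
move=> cf; elim: s => [|i s ih].
  have -> : (fun x => \sum_(i <- [::]) f i x) = cst 0.
    by apply/funext => x; rewrite big_nil.
  by move=> x; exact: cvg_cst.
have -> : (fun x => \sum_(i <- i :: s) f i x)
    = (fun x => f i x + \sum_(i <- s) f i x).
  by apply/funext => x; rewrite big_cons.
by move=> x; apply: (@cvgD _ R^o); [exact: cf|exact: ih].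
Qed.

Lemma sqn_mul_tr_continuous m n (A : 'M[R]_(m, n)) :
  continuous (fun v : 'rV[R]_n => sqn (A *m v^T)).
Proof.
have -> : (fun v : 'rV[R]_n => sqn (A *m v^T))
    = (fun v => \sum_i (\sum_j A i j * v ord0 j) ^+ 2).
  apply/funext => v; rewrite sqnE; apply: eq_bigr => i _.
  by rewrite big_ord1 mxE; congr (_ ^+ 2); apply: eq_bigr => j _; rewrite mxE.
apply: continuous_sum => i v.
apply: (@continuous_comp _ _ _ (fun v : 'rV[R]_n => \sum_j A i j * v ord0 j)
  (fun x : R => x ^+ 2)); last exact: exprn_continuous.
apply: continuous_sum => j {}v.
apply: (@continuousM R _ (cst (A i j)) (fun v : 'rV[R]_n => v ord0 j)).
  exact: cst_continuous.
exact: coord_continuous.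
Qed.

(** The maximum is attained on the compact unit sphere and extends by homogeneity; the index [n.+1]
    keeps the sphere nonempty. *)
Lemma sqn_mul_max m n (A : 'M[R]_(m, n.+1)) :
  exists2 v : 'cV[R]_n.+1, sqn v = 1 &
    forall x : 'cV[R]_n.+1, sqn (A *m x) <= sqn (A *m v) * sqn x.
Proof.
set S := [set v : 'rV[R]_n.+1 | sqn v = 1].
have SE : S = (fun v : 'rV[R]_n.+1 => sqn (1%:M *m v^T)) @^-1` [set 1].
  by apply/seteqP; split => v /=; rewrite /S /= mul1mx sqn_tr.
have S0 : S !=set0.
  exists (delta_mx 0 0); rewrite /S /= sqnE big_ord1 (bigD1 ord0)//= big1.
    by rewrite mxE !eqxx expr1n addr0.
  by move=> j j0; rewrite mxE (negbTE j0) andbF expr0n.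
have cS : compact S.
  apply: bounded_closed_compact.
    exists 1; split; first exact: num_real.
    move=> M M1 v /= Sv; rewrite /Num.norm/= mx_normrE.
    apply: bigmax_le => [|[i j] _ /=]; first by rewrite ltW// (lt_trans ltr01).
    apply: le_trans (ltW M1); rewrite -(@expr_le1 _ 2) ?normr_ge0//.
    rewrite real_normK ?num_real// -Sv sqnE (bigD1 i)//= (bigD1 j)//= -addrA lerDl.
    by rewrite addr_ge0// ?sumr_ge0// => *; rewrite ?sqr_ge0// ?sumr_ge0// => *; rewrite sqr_ge0.
  rewrite SE; apply: preimage_closed; last exact: closed_eq.
  by move=> v _; exact: sqn_mul_tr_continuous.
have [v vS vmax] : exists2 v, v \in S &
    forall t, t \in S -> sqn (A *m t^T) <= sqn (A *m v^T).
  apply: (compact_EVT_max S0 cS).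
  by apply: continuous_subspaceT; exact: sqn_mul_tr_continuous.
exists v^T => [|x]; first by rewrite sqn_tr; move/set_mem: vS.
have [->|x0] := eqVneq x 0; first by rewrite mulmx0 !sqn0 mulr0.
have fx : 0 < frob_norm x by rewrite frob_normE sqrtr_gt0 sqn_gt0.
have := vmax ((frob_norm x)^-1 *: x)^T; rewrite trmxK -scalemxAr sqnZ.
rewrite exprVn sqr_frob_norm ler_pdivrMl ?sqn_gt0// mulrC; apply.
apply/mem_set; rewrite /S /= sqn_tr sqnZ exprVn sqr_frob_norm mulVf//.
by rewrite sqn_eq0.
Qed.

(* By a Householder reflection. *)
Lemma orthogonal_transport n (u v : 'cV[R]_n) : sqn u = sqn v ->
  exists2 Q : 'M[R]_n, orthonormal_cols Q & Q *m u = v.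
Proof.
move=> uv; have [->|nuv] := eqVneq u v.
  by exists 1%:M; rewrite ?mul1mx// /orthonormal_cols trmx1 mul1mx.
set w := v - u; have w0 : sqn w != 0 by rewrite sqn_eq0 subr_eq0 eq_sym.
set Q := 1%:M - (2 / sqn w) *: (w *m w^T).
have Qsym : Q^T = Q.
  by rewrite /Q linearB /= trmx1 linearZ /= trmx_mul trmxK.
have ww : w^T *m w = (sqn w)%:M by rewrite [LHS]mx11_scalar /sqn /ip [X in _ = X%:M]/mxtrace big_ord1.
exists Q.
  set X := _ *: _ in Q Qsym *.
  have XX : X *m X = X + X.
    rewrite /X -scalemxAl -scalemxAr -mulmxA (mulmxA w^T w) ww mul_scalar_mx.
    by rewrite -scalemxAr !scalerA -scalerDl; congr (_ *: _); field.
  rewrite /orthonormal_cols Qsym /Q mulmxBl mul1mx mulmxBr mulmx1 XX.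
  by rewrite opprB addrK subrK.
have wu : w^T *m u = (- (sqn w / 2))%:M.
  rewrite [LHS]mx11_scalar; congr (_%:M).
  have -> : (w^T *m u) ord0 ord0 = ip w u by rewrite /ip /mxtrace big_ord1.
  have -> : sqn w = sqn v - 2 * ip v u + sqn u.
    by rewrite /w sqnD sqnN -scaleN1r ipZr; ring.
  by rewrite /w ipDl -scaleN1r ipZl -/(sqn u) uv; field.
rewrite mulmxBl mul1mx -scalemxAl -mulmxA wu mul_mx_scalar scalerA.
have -> : 2 / sqn w * - (sqn w / 2) = -1 by field.
by rewrite scaleN1r opprK addrC subrK.
Qed.

End SingularValues.

Section SVD.
Variable R : realType.
Implicit Types m n : nat.

Lemma sqn_delta n (i : 'I_n) : sqn (delta_mx i ord0 : 'cV[R]_n) = 1.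
Proof. by rewrite /sqn /ip trmx_delta mul_delta_mx /mxtrace big_ord1 mxE !eqxx. Qed.

Lemma orthonormal_cols_tr n (Q : 'M[R]_n) : orthonormal_cols Q -> Q *m Q^T = 1%:M.
Proof. exact: mulmx1C. Qed.

Lemma sqn_orthonormal n l p (H : 'M[R]_(n, l)) (A : 'M[R]_(l, p)) :
  orthonormal_cols H -> sqn (H *m A) = sqn A.
Proof. by move=> Ho; rewrite /sqn ip_mull mulmxA Ho mul1mx. Qed.

Lemma rect_diagS m n (s : nat -> R) :
  rect_diag (1 + m) (1 + n) s =
  block_mx (s 0%N)%:M 0 0 (rect_diag m n (fun i => s i.+1)).
Proof.
apply/matrixP => i j; rewrite -(fintype.splitK i) -(fintype.splitK j).
case: (fintype.split i) => i'; case: (fintype.split j) => j'; rewrite /unsplit.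
- by rewrite block_mxEul !mxE !ord1.
- by rewrite block_mxEur !mxE /= !ord1.
- by rewrite block_mxEdl !mxE /= !ord1.
- by rewrite block_mxEdr !mxE /= !add1n eqSS.
Qed.

Lemma orthonormal_block n (Q : 'M[R]_n) :
  orthonormal_cols Q -> orthonormal_cols (block_mx (1%:M : 'M[R]_1) 0 0 Q).
Proof.
move=> Qo; rewrite /orthonormal_cols tr_block_mx mulmx_block !trmx0 trmx1.
by rewrite !mul0mx !mulmx0 !addr0 !add0r mul1mx Qo -scalar_mx_block.
Qed.

Let svd_bounded m n (A : 'M[R]_(m, n)) U s V :=
  is_svd A U s V /\ forall c, 0 <= c -> opb A (c ^+ 2) -> s 0%N <= c.

Let orthonormal_id k : orthonormal_cols (1%:M : 'M[R]_k).
Proof. by rewrite /orthonormal_cols trmx1 mul1mx. Qed.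

Let svd_bounded0 m n : svd_bounded (0 : 'M[R]_(m, n)) 1%:M (fun=> 0) 1%:M.
Proof.
split=> //; split=> //; rewrite mul1mx trmx1 mulmx1.
by apply/matrixP => i j; rewrite !mxE if_same.
Qed.

(* The bound carried by svd_bounded makes the singular values decrease. *)
Lemma svd_bounded_ex m n (A : 'M[R]_(m, n)) : exists U s V, svd_bounded A U s V.
Proof.
elim: m n A => [|m ih] n A.
  by rewrite flatmx0; do 3!eexists; exact: svd_bounded0.
case: n A => [|n] A; first by rewrite thinmx0; do 3!eexists; exact: svd_bounded0.
have [v v1 vmax] := sqn_mul_max A.
have [Av0|Avn0] := eqVneq (A *m v) 0.
  have -> : A = 0.
    apply/eqP; rewrite -sqn_eq0 eq_le sqn_ge0 andbT sqn_cols big1// => j _.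
    apply/eqP; rewrite eq_le sqn_ge0 andbT colE (le_trans (vmax _))//.
    by rewrite Av0 sqn0 mul0r.
  by do 3!eexists; exact: svd_bounded0.
set sg := frob_norm (A *m v).
have sg0 : 0 < sg by rewrite /sg frob_normE sqrtr_gt0 sqn_gt0.
have sg2 : sg ^+ 2 = sqn (A *m v) by exact: sqr_frob_norm.
have Asg : opb A (sg ^+ 2) by move=> x; rewrite sg2.
set u := sg^-1 *: (A *m v).
have u1 : sqn u = 1 by rewrite sqnZ exprVn -sg2 mulVf// expf_neq0// gt_eqF.
have Avu : A *m v = sg *: u by rewrite scalerA divff ?scale1r// gt_eqF.
(* In the bases given by [Q] and [W], the first column of [B = W^T A Q] becomes [sg] times the first
   unit vector. *)
have [Q Qo Qe] := @orthogonal_transport R n.+1 (delta_mx 0 0) v (etrans (sqn_delta _) (esym v1)).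
have [W Wo We] := @orthogonal_transport R m.+1 (delta_mx 0 0) u (etrans (sqn_delta _) (esym u1)).
have WWt := orthonormal_cols_tr Wo; have QQt := orthonormal_cols_tr Qo.
have [B BdE] : exists B : 'M[R]_(1 + m, 1 + n), B = W^T *m A *m Q by eexists.
have Bsg : opb B (sg ^+ 2).
  move=> x; have Wto : orthonormal_cols W^T by rewrite /orthonormal_cols trmxK.
  rewrite BdE -!mulmxA (sqn_orthonormal _ Wto) (le_trans (Asg _))//.
  by rewrite (sqn_orthonormal _ Qo).
have Be : B *m delta_mx 0 0 = sg *: delta_mx 0 0 :> 'cV_(1 + m).
  by rewrite BdE -!mulmxA Qe Avu -scalemxAr -We mulmxA Wo mul1mx.
have lB : lsubmx B = col_mx sg%:M 0.
  have BeE i : B i 0 = (sg *: delta_mx 0 0 : 'cV_(1 + m)) i 0.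
    by rewrite -Be -colE [RHS]mxE.
  have l0 : lshift n 0 = 0 :> 'I_(1 + n) by apply: val_inj.
  apply/matrixP => i j; rewrite mxE ord1 l0 BeE -(fintype.splitK i).
  case: (fintype.split i) => k; rewrite /unsplit ?col_mxEu ?col_mxEd !mxE ?ord1.
    by rewrite -(inj_eq val_inj) /= mulr1.
  by rewrite -(inj_eq val_inj) /= mulr0.
have ul : ulsubmx B = sg%:M.
  apply/matrixP => i j; have := congr1 (fun M : 'M[R]_(1 + m, 1) => M (lshift m i) j) lB.
  by rewrite /= col_mxEu !mxE => <-.
have dl : dlsubmx B = 0.
  apply/matrixP => i j; have := congr1 (fun M : 'M[R]_(1 + m, 1) => M (rshift 1 i) j) lB.
  by rewrite /= col_mxEd !mxE => <-.
(* The first row has squared norm [sg^2 + |ursubmx B|^2], which by maximality of [sg] is at most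
   [sg^2]. *)
have ur : ursubmx B = 0.
  set x := B^T *m (delta_mx 0 0 : 'cV[R]_(1 + m)).
  have xE : x = col_mx sg%:M (ursubmx B)^T.
    rewrite /x -[B in LHS]submxK ul dl tr_block_mx.
    have -> : delta_mx 0 0 = col_mx 1%:M 0 :> 'cV[R]_(1 + m).
      apply/matrixP => i j; rewrite ord1 -(fintype.splitK i); case: (fintype.split i) => k.
        by rewrite col_mxEu !mxE !ord1.
      by rewrite col_mxEd !mxE.
    by rewrite mul_block_col !mulmx1 !mulmx0 !addr0 tr_scalar_mx.
  have xx : sqn x <= sg ^+ 2.
    rewrite -[leRHS]mulr1 -(sqn_delta (0 : 'I_(1 + m))).
    by apply: opb_tr => //; exact: sqr_ge0.
  have sx : sqn x = sg ^+ 2 + sqn (ursubmx B).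
    rewrite xE sqnE big_split_ord /= big_ord1 big_ord1 col_mxEu mxE eqxx mulr1n.
    rewrite -(sqn_tr (ursubmx B)) sqnE; congr (_ + _).
    by apply: eq_bigr => i _; rewrite !big_ord1 col_mxEd.
  apply/eqP; rewrite -sqn_eq0 eq_le sqn_ge0 andbT.
  by move: xx; rewrite sx gerDl.
have BE : B = block_mx sg%:M 0 0 (drsubmx B) by rewrite -[LHS]submxK ul dl ur.
have [U [s [V [[Uo Vo [s0 smon] send drE] sle]]]] := ih n (drsubmx B).
have drsg : opb (drsubmx B) (sg ^+ 2).
  move=> x; have := Bsg (col_mx 0 x); rewrite BE mul_block_col !mulmx0 !mul0mx add0r.
  have cx p (y : 'cV[R]_p) : sqn (col_mx (0 : 'cV_1) y) = sqn y.
    rewrite sqnE big_split_ord /= big_ord1 big_ord1 col_mxEu mxE expr0n add0r sqnE.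
    by apply: eq_bigr => i _; rewrite !big_ord1 col_mxEd.
  by rewrite add0r !cx block_mxKdr.
exists (W *m block_mx (1%:M : 'M[R]_1) 0 0 U), (fun i => if i is i'.+1 then s i' else sg),
  (Q *m block_mx (1%:M : 'M[R]_1) 0 0 V); split; last first.
  move=> c c0 Ac; have := Ac v; rewrite v1 mulr1 -sg2 ler_sqr ?nnegrE//.
  exact: ltW.
split.
- rewrite /orthonormal_cols trmx_mul -mulmxA (mulmxA W^T) Wo mul1mx.
  exact: orthonormal_block.
- rewrite /orthonormal_cols trmx_mul -mulmxA (mulmxA Q^T) Qo mul1mx.
  exact: orthonormal_block.
- split=> [[|i]|[|i] [|j]]//=; first exact: ltW.
    by move=> _; rewrite (le_trans (smon 0%N j _))// sle// ltW.
  by rewrite ltnS; exact: smon.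
- by case=> [|i]; rewrite minnSS ?ltn0// ltnS; exact: send.
- have -> : A = W *m B *m Q^T.
    by rewrite BdE !mulmxA WWt mul1mx -mulmxA QQt mulmx1.
  rewrite BE drE trmx_mul -!mulmxA; congr (_ *m _); rewrite !mulmxA; congr (_ *m _).
  rewrite (rect_diagS m n (fun i => if i is i'.+1 then s i' else sg)).
  rewrite (@tr_block_mx R 1 n 1 n) !trmx0 trmx1.
  rewrite (@mulmx_block R 1 m 1 m 1 n) (@mulmx_block R 1 m 1 n 1 n).
  by rewrite !mul0mx !mulmx0 !mul1mx !mulmx1 !addr0 !mul0mx !add0r.
Qed.

Lemma svdP m n (A : 'M[R]_(m, n)) :
  is_svd A (svd A).1.1 (svd A).1.2 (svd A).2.
Proof.
have [U [s [V [hA _]]]] := svd_bounded_ex A.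
exact: (@xgetPex _ (1%:M, fun=> 0, 1%:M)
  [set t | is_svd A t.1.1 t.1.2 t.2] (ex_intro _ (U, s, V) hA)).
Qed.

End SVD.

(** * Singular values, truncation and the optimality of the tail *)

Section Truncation.
Variable R : realType.
Implicit Types m n : nat.

Lemma sqn_rect_diag m n s (y : 'cV[R]_n) :
  sqn (rect_diag m n s *m y) = \sum_(j < n) (if (j < m)%N then s j ^+ 2 else 0) * y j 0 ^+ 2.
Proof.
pose f (i : 'I_m) (j : 'I_n) : R := if (i : nat) == j then s j ^+ 2 * y j 0 ^+ 2 else 0.
have -> : sqn (rect_diag m n s *m y) = \sum_i \sum_j f i j.
  rewrite sqnE; apply: eq_bigr => i _; rewrite big_ord1 mxE /f.
  have [ni|ni] := leqP n i.
    rewrite !big1 ?expr0n// => j _; rewrite ?mxE.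
      by rewrite gtn_eqF// (leq_trans (ltn_ord j)).
    by rewrite gtn_eqF ?mul0r// (leq_trans (ltn_ord j)).
  rewrite (bigD1 (Ordinal ni))//= big1 => [|j ji]; last first.
    rewrite mxE; case: eqP => [ij|]; last by rewrite mul0r.
    by move/eqP: ji; case; apply: val_inj.
  rewrite [RHS](bigD1 (Ordinal ni))//= [X in _ = _ + X]big1 => [|j ji]; last first.
    by case: eqP => [ij|//]; move/eqP: ji; case; apply: val_inj.
  by rewrite !addr0 mxE eqxx exprMn.
rewrite exchange_big; apply: eq_bigr => j _; rewrite /f.
have [jm|jm] := ltnP j m.
  rewrite (bigD1 (Ordinal jm))//= eqxx big1 ?addr0// => i ij.
  by case: eqP => [ij'|//]; move/eqP: ij; case; apply: val_inj.
rewrite mul0r big1// => i _.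
by rewrite ltn_eqF// (leq_trans (ltn_ord i)).
Qed.

Lemma sqn_svd m n (A : 'M[R]_(m, n)) U s V (x : 'cV[R]_n) : is_svd A U s V ->
  sqn (A *m x) = \sum_(j < n) (if (j < m)%N then s j ^+ 2 else 0) * (V^T *m x) j 0 ^+ 2.
Proof.
by case=> Uo _ _ _ ->; rewrite -!mulmxA (sqn_orthonormal _ Uo) sqn_rect_diag.
Qed.

(** In the coordinates [V^T x] the form is diagonal. Since [r <= m], all [r] coefficients are
    squares of singular values, the least one at the 0-based index [r.-1]. *)
Lemma lob_sing_val m r (A : 'M[R]_(m, r)) : (0 < r <= m)%N ->
  lob A^T (sing_val A r ^+ 2).
Proof.
move=> /andP[r0 rm] x; rewrite trmxK (sqn_svd _ (svdP A)) /sing_val.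
case: (svdP A) => _ Vo [s0 smon] _ _; set s := (svd A).1.2 in s0 smon *.
set V := (svd A).2 in Vo *.
have Vto : orthonormal_cols V^T by rewrite /orthonormal_cols trmxK orthonormal_cols_tr.
rewrite -(sqn_orthonormal x Vto) sqnE mulr_sumr; apply: ler_sum => j _.
rewrite big_ord1 (leq_trans (ltn_ord j) rm) ler_wpM2r ?sqr_ge0//.
by rewrite ler_sqr ?nnegrE// smon// -ltnS prednK.
Qed.

Lemma sing_val_ge0 m n (A : 'M[R]_(m, n)) j : 0 <= sing_val A j.
Proof. by case: (svdP A) => _ _ [s0 _] _ _; exact: s0. Qed.

(** If the last singular value vanished, the last column of [V] would be a nonzero vector in the
    kernel of [A]. *)
Lemma sing_val_gt0 m r (A : 'M[R]_(m, r)) : (0 < r <= m)%N ->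
  \rank A = r -> 0 < sing_val A r.
Proof.
move=> /andP[r0 rm] Ar; rewrite lt_def sing_val_ge0 andbT; apply/eqP => sr0.
case: (svdP A) => Uo Vo [s0 smon] _ AE; rewrite /sing_val in sr0.
set s := (svd A).1.2 in s0 smon AE sr0; set V := (svd A).2 in Vo AE.
have lr : (r.-1 < r)%N by rewrite prednK.
set e : 'cV[R]_r := delta_mx (Ordinal lr) 0.
have Af : row_free A^T by rewrite /row_free mxrank_tr Ar.
have Ae : A *m (V *m e) = 0.
  apply/eqP; rewrite -sqn_eq0 (sqn_svd _ (svdP A)) -/s -/V mulmxA Vo mul1mx.
  rewrite big1// => j _; rewrite mxE eqxx andbT.
  case: eqP => [->|]; last by rewrite expr0n mulr0.
  by rewrite /= sr0 expr0n /= if_same mul0r.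
have : V *m e = 0.
  apply: trmx_inj; apply: (row_free_inj Af).
  by rewrite -trmx_mul Ae !trmx0 mul0mx.
move=> /(congr1 (mulmx V^T)); rewrite mulmxA Vo mul1mx mulmx0.
by move=> /(congr1 (@sqn R r 1)); rewrite sqn_delta sqn0 => /eqP; rewrite oner_eq0.
Qed.

Let ones : nat -> R := fun=> 1.

Section TailSv.
Variables (m n r : nat) (M : 'M[R]_(m, n)).
Hypothesis rmn : (r < minn m n)%N.

Let U := (svd M).1.1.
Let s := (svd M).1.2.
Let V := (svd M).2.
Let J : 'M[R]_(r, n) := rect_diag r n ones.
Let C := J *m V^T.
Let head i := if (i < r)%N then s i else 0.
Let tail i := if (i < r)%N then 0 else s i.

Let trunc_mxE : trunc_mx r M = U *m rect_diag m n head *m V^T.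
Proof. by rewrite /trunc_mx /head /U /s /V; case: (svd M) => [[? ?] ?]. Qed.

Lemma rank_trunc_mx : (\rank (trunc_mx r M) <= r)%N.
Proof.
rewrite trunc_mxE.
(* The truncated diagonal factors through dimension [r], as [J] selects the first [r]
   coordinates. *)
have -> : rect_diag m n head = rect_diag m r s *m J.
  apply/matrixP => i j; rewrite !mxE /head.
  have [jr|jr] := ltnP j r.
    rewrite (bigD1 (Ordinal jr))//= !mxE /= eqxx mulr1 big1 ?addr0 => [|k kj].
      by case: eqP => // ->; rewrite jr.
    rewrite !mxE; case: eqP => [ik|]; last by rewrite mul0r.
    by case: eqP => [kj'|]; rewrite ?mulr0//; move/eqP: kj; case; apply: val_inj.
  rewrite big1 => [|k _]; last first.
    rewrite !mxE; case: eqP; rewrite ?mul0r//= => _.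
    by rewrite ltn_eqF ?mulr0// (leq_trans (ltn_ord k)).
  by case: eqP => // ->; rewrite ltnNge jr.
rewrite mulmxA -mulmxA (leq_trans (mxrankM_maxl _ _))//.
exact: rank_leq_col.
Qed.

(** This is [eckart_young] for the head and tail of the decomposition: the rows of [C] are the first
    [r] right singular vectors, and the 0-based [s r] is the largest singular value in the tail. *)
Lemma tail_sv_le N (Z : 'M[R]_(m, n)) :
  (\rank Z <= r)%N -> tail_sv N r M <= mxnorm N (M - Z).
Proof.
move=> Zr; have [rm rn] : (r < m)%N /\ (r < n)%N by move: rmn; rewrite leq_min => /andP.
have [Uo Vo [s0 smon] _ ME] := svdP M; rewrite -/U -/s -/V in Uo Vo s0 smon ME.
have Vto : orthonormal_cols V^T by rewrite /orthonormal_cols trmxK orthonormal_cols_tr.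
have DE : rect_diag m n s = rect_diag m n head + rect_diag m n tail.
  apply/matrixP => i j; rewrite !mxE /head /tail.
  by case: eqP; rewrite ?addr0//; case: ifP; rewrite ?addr0 ?add0r.
set N1 := trunc_mx r M; set N2 := U *m rect_diag m n tail *m V^T.
have MN : M = N1 + N2.
  by rewrite {1}ME DE mulmxDr mulmxDl /N1 trunc_mxE.
have N2E : M - trunc_mx r M = N2 by rewrite {1}MN addrC addKr.
rewrite /tail_sv N2E {1}MN.
have JJ : J *m J^T = 1%:M.
  apply/matrixP => i j; rewrite !mxE.
  have ni : (i < n)%N by rewrite (ltn_trans (ltn_ord i)).
  rewrite (bigD1 (Ordinal ni))//= !mxE /= eqxx mul1r big1 ?addr0 => [|k ki].
    by rewrite eq_sym -val_eqE /ones; case: eqP.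
  rewrite !mxE; case: eqP => [ik|]; last by rewrite mul0r.
  by move/eqP: ki; case; apply: val_inj.
have CC : C *m C^T = 1%:M.
  by rewrite /C trmx_mul trmxK mulmxA -(mulmxA J) Vo mulmx1.
have Cf : row_free C by apply/row_freeP; exists C^T.
have sqnP (x : 'cV_n) : sqn (rowproj C *m x) = \sum_(j < n) (if (j < r)%N then 1 else 0) * (V^T *m x) j 0 ^+ 2.
  have -> : rowproj C = C^T *m C by rewrite /rowproj /rinv CC invmx1 mulmx1.
  have Co : orthonormal_cols C^T by rewrite /orthonormal_cols trmxK.
  rewrite -mulmxA (sqn_orthonormal _ Co) /C -mulmxA sqn_rect_diag.
  by apply: eq_bigr => j _; rewrite /ones expr1n.
have sqnx (x : 'cV_n) : sqn x = \sum_(j < n) (V^T *m x) j 0 ^+ 2.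
  by rewrite -(sqn_orthonormal x Vto) sqnE; apply: eq_bigr => j _; rewrite big_ord1.
apply: (@eckart_young R m n r N1 N2 Z C (s r ^+ 2)) => //.
- exact: sqr_ge0.
- rewrite /N1 trunc_mxE /N2 !trmx_mul trmxK -!mulmxA (mulmxA U^T) Uo mul1mx.
  rewrite (mulmxA _^T (rect_diag m n tail)).
  have -> : (rect_diag m n head)^T *m rect_diag m n tail = 0.
    apply/matrixP => i j; rewrite !mxE big1// => k _; rewrite !mxE /head /tail.
    by case: eqP; rewrite ?mul0r// => _; case: eqP; case: ifP; rewrite ?mul0r ?mulr0.
  by rewrite mul0mx mulmx0.
- move=> x; rewrite sqnP /N1 trunc_mxE -!mulmxA (sqn_orthonormal _ Uo) sqn_rect_diag.
  rewrite mulr_sumr; apply: ler_sum => j _; rewrite /head mulrA ler_wpM2r ?sqr_ge0//.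
  case: ifP => jr; last by rewrite mulr0; case: ifP; rewrite ?expr0n//.
  rewrite (ltn_trans jr rm) mulr1 ler_sqr ?nnegrE//; apply: smon.
  exact: ltnW.
- move=> x; have := sqn_proj_split (rowproj_sym C) (rowproj_idem Cf) x.
  move/eqP; rewrite addrC -subr_eq => /eqP <-; rewrite sqnP sqnx -sumrB.
  rewrite /N2 -!mulmxA (sqn_orthonormal _ Uo) sqn_rect_diag mulr_sumr.
  apply: ler_sum => j _; rewrite /tail; case: (ltnP j r) => jr.
    by rewrite expr0n /= if_same mul0r mul1r subrr mulr0.
  rewrite mul0r subr0 ler_wpM2r ?sqr_ge0//; case: ifP => _; last exact: sqr_ge0.
  by rewrite ler_sqr ?nnegrE//; exact: smon.
Qed.

End TailSv.

Lemma tail_sv_ge0 N m n r (M : 'M[R]_(m, n)) : 0 <= tail_sv N r M.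
Proof. exact: mxnorm_ge0. Qed.

End Truncation.

(** * Measurability of the error and of the tail *)

Section Measurability.
Variables (R : realType) (d : measure_display) (Omega : measurableType d).
Implicit Types m n : nat.

(** Openness is phrased by Frobenius balls, the form in which the semicontinuity estimates produce
    it. *)
Definition frob_open {m n} (V : set 'M[R]_(m, n)) :=
  forall M, V M -> exists2 e : R, 0 < e &
    forall M' : 'M[R]_(m, n), frob_norm (M' - M) < e -> V M'.

Lemma frob_norm_entries m n (A : 'M[R]_(m, n)) (e : R) : 0 <= e ->
  (forall i j, `|A i j| <= e) -> frob_norm A <= (m * n)%:R * e.
Proof.
move=> e0 Ae; rewrite frob_norm_le ?mulr_ge0// sqnE.
apply: (@le_trans _ _ (\sum_(i < m) \sum_(j < n) e ^+ 2)).
  apply: ler_sum => i _; apply: ler_sum => j _.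
  by rewrite -real_normK ?num_real// ler_sqr ?nnegrE.
rewrite !sumr_const !card_ord -mulrnA mulnC exprMn -[leLHS]mulr_natl ler_wpM2r ?sqr_ge0//.
by rewrite -natrX ler_nat; case: (m * n)%N => // k; rewrite -mulnn leq_pmulr.
Qed.

(** An open set is the union of the countably many cubes with rational centre and radius that it
    contains; membership in a cube is a finite conjunction of measurable conditions on entries. *)
Lemma measurable_frob_open m n (M : Omega -> 'M[R]_(m, n)) (V : set 'M[R]_(m, n)) :
  (forall i j, measurable_fun setT (fun w => M w i j)) -> frob_open V ->
  measurable [set w | V (M w)].
Proof.
move=> mM oV.
pose near (A : 'M[R]_(m, n)) (q : 'M[rat]_(m, n) * rat) :=
  forall i j, `|A i j - ratr (q.1 i j)| < ratr q.2.
pose B q := [set w | near (M w) q /\ forall A, near A q -> V A].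
have -> : [set w | V (M w)] = \bigcup_q B q.
  apply/seteqP; split => [w /= Vw|w [q _ [qw qV]]]; last exact: qV.
  have [e e0 eV] := oV _ Vw.
  (* Two points of a cube of radius below [de] differ by at most [2 de] in each entry, hence by less
     than [e] in Frobenius norm; the [+ 1] also covers empty matrices. *)
  set de := e / ((m * n)%:R + 1) / 2.
  have mn0 : 0 < (m * n)%:R + 1 :> R by rewrite ltr_wpDl.
  have de0 : 0 < de by rewrite !divr_gt0.
  have [q2 q2de] := rat_in_itvoo de0.
  move: q2de; rewrite in_itv/= => /andP[q20 q2d].
  have apx (x : R) : exists q, `|x - ratr q| < ratr q2.
    have [q] := @rat_in_itvoo R (x - ratr q2) (x + ratr q2) (ltac:(lra)).
    rewrite in_itv/= => /andP[h1 h2]; exists q.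
    by rewrite ltr_norml; lra.
  have /choice[f hf] : forall ij : 'I_m * 'I_n, exists q, `|M w ij.1 ij.2 - ratr q| < ratr q2.
    by move=> ij; exact: apx.
  exists (\matrix_(i, j) f (i, j), q2) => //; split.
    by move=> i j; rewrite /= mxE; exact: (hf (i, j)).
  move=> A Aq; apply: eV.
  apply: (@le_lt_trans _ _ ((m * n)%:R * (2 * de))).
    apply: frob_norm_entries => [|i j]; first by rewrite mulr_ge0// ltW.
    have := Aq i j; have := hf (i, j); rewrite /= !mxE !ltr_norml => ? ?.
    by rewrite ler_norml; lra.
  rewrite /de (_ : _ * (2 * _) = (m * n)%:R / ((m * n)%:R + 1) * e); last first.
    by field; rewrite gt_eqF.
  by rewrite gtr_pMl// ltr_pdivrMr// mul1r ltrDl.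
apply: countable_bigcupT_measurable; first exact: countableP.
move=> q; have [qV|qV] := pselect (forall A, near A q -> V A); last first.
  by rewrite (_ : B q = set0)//; apply/seteqP; split => // w [].
have -> : B q = \bigcap_(ij in [set: 'I_m * 'I_n])
    [set w | `|M w ij.1 ij.2 - ratr (q.1 ij.1 ij.2)| < ratr q.2].
  apply/seteqP; split => [w [qw _] [i j] _|w qw]; first exact: qw.
  by split=> // i j; exact: (qw (i, j)).
apply: fin_bigcap_measurable => // ij _.
rewrite -[X in measurable X]setTI.
have mf : measurable_fun setT (fun w => `|M w ij.1 ij.2 - ratr (q.1 ij.1 ij.2)|).
  apply: measurableT_comp; first exact: normr_measurable.
  by apply: measurable_funB => //; exact: mM.
have := mf measurableT `]-oo, ratr q.2[%classic (measurable_itv _).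
by rewrite preimage_itvNyo.
Qed.

Lemma measurable_fun_usc m n (M : Omega -> 'M[R]_(m, n)) (f : 'M[R]_(m, n) -> R) :
  (forall i j, measurable_fun setT (fun w => M w i j)) ->
  (forall c, frob_open [set A | f A < c]) ->
  measurable_fun setT (fun w => f (M w)).
Proof.
move=> mM fo mD; apply: (measurability _ (RGenInftyO.measurableE R)) => //.
move=> _ [_ [c ->] <-]; rewrite setTI preimage_itvNyo.
exact: (measurable_frob_open mM (fo c)).
Qed.

(** Freeze the [Z] that is optimal at [M]. Then [M' K] bounds the error at every [M'], with equality
    of norms at [M], and its norm is continuous in [M']. *)
Lemma sketch_err_usc N m n l (H : 'M[R]_(n, l)) (T : 'M[R]_l) (c : R) :
  T \in unitmx -> frob_open [set M : 'M[R]_(m, n) | sketch_err N M H T < c].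
Proof.
move=> Tu M /= Mc; have eE := sketch_err_eq N M H Tu.
set Z := invmx T *m _ in eE; set K := 1%:M - H *m Z.
have KE (A : 'M[R]_(m, n)) : A - A *m H *m Z = A *m K.
  by rewrite /K mulmxBr mulmx1 (mulmxA A H).
set k := frob_norm K; have k0 : 0 <= k by exact: frob_norm_ge0.
have k1 : 0 < k + 1 by rewrite ltr_wpDl.
exists ((c - sketch_err N M H T) / (k + 1)); first by rewrite divr_gt0// subr_gt0.
move=> M' hM'; apply: le_lt_trans (sketch_err_le N M' H Z Tu) _.
rewrite KE -[M'](subrK M) mulmxDl (le_lt_trans (mxnormD _ _ _))//.
rewrite -(KE M) -eE -ltrBrDr.
have h : mxnorm N ((M' - M) *m K) <= k * frob_norm (M' - M).
  rewrite (le_trans (mxnorm_mulr (c := k) _ _ k0 _))//.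
    by rewrite /k sqr_frob_norm; exact: opb_frob.
  by rewrite ler_wpM2l// mxnorm_le_frob.
apply: le_lt_trans h _; move: hM'; rewrite ltr_pdivlMr//; apply: le_lt_trans.
by rewrite mulrC ler_wpM2l ?frob_norm_ge0// lerDl.
Qed.

Lemma tail_sv_usc N m n r (c : R) : (r < minn m n)%N ->
  frob_open [set M : 'M[R]_(m, n) | tail_sv N r M < c].
Proof.
move=> rmn M /= Mc; exists (c - tail_sv N r M); first by rewrite subr_gt0.
move=> M' hM' /=; apply: le_lt_trans (tail_sv_le M' rmn N (rank_trunc_mx r M)) _.
rewrite (_ : M' - _ = (M' - M) + (M - trunc_mx r M)); last by rewrite addrA subrK.
rewrite (le_lt_trans (mxnormD _ _ _))// -ltrBrDr.
by rewrite (le_lt_trans (mxnorm_le_frob _ _)).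
Qed.

End Measurability.

(** * Gaussian quadratic forms *)

Section IndependentIntegral.
Local Open Scope ereal_scope.
Variables (d : measure_display) (Omega : measurableType d) (R : realType).
Variables (P : probability Omega R) (X : {RV P >-> R}) (C : set (set Omega)).
Hypotheses (Cm : C `<=` measurable) (CI : setI_closed C) (CT : C setT).
Hypothesis indep : forall A B, measurable A -> C B ->
  P (X @^-1` A `&` B) = P (X @^-1` A) * P B.

(** The space [Omega] with the smaller sigma-algebra generated by [C]: functions measurable on it
    carry only information independent of [X]. *)
Let T2 := g_sigma_algebraType C.

Let sCm : <<s C >> `<=` @measurable _ Omega.
Proof. exact: (smallest_sub (@sigma_algebra_measurable _ Omega) Cm). Qed.

(** For fixed [A], both sides are finite measures in [B] that agree on the pi-system [C]. *)
Lemma indep_sigma_algebra A B : measurable A -> <<s C >> B ->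
  P (X @^-1` A `&` B) = P (X @^-1` A) * P B.
Proof.
move=> mA sB.
have mXA : measurable (X @^-1` A) by rewrite -[X in measurable X]setTI; exact: measurable_funP.
have fA : (0 <= fine (P (X @^-1` A)))%R by rewrite fine_ge0.
pose m1 : {measure set Omega -> \bar R} := mrestr P mXA.
pose m2 : {measure set Omega -> \bar R} := mscale (NngNum fA) P.
have m2E D : m2 D = P (X @^-1` A) * P D.
  by rewrite /m2 /= /mscale /= fineK// fin_num_measure.
rewrite -m2E setIC -[LHS]/(m1 B).
apply: (@g_sigma_algebra_measure_unique _ R Omega C Cm (fun=> setT)) => //.
- by rewrite bigcup_const//; exists 0%N.
- by move=> D CD; rewrite m2E -indep//= /mrestr setIC.
- by move=> _; rewrite /m1 /= /mrestr setTI (le_lt_trans (probability_le1 _ _)) ?ltry.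
Qed.

Let mid : measurable_fun [set: Omega] (idfun : Omega -> T2).
Proof. by move=> _ B mB; rewrite setTI; apply: sCm. Qed.

Let mpair : measurable_fun [set: Omega] (fun w => (X w, w : T2)).
Proof. by apply: measurable_fun_pair => //; exact: mid. Qed.

(** By independence the joint law of [X] and the identity into [T2] is a product measure, so
    Tonelli's theorem integrates [X] out first. *)
Lemma integral_indep (f : R * T2 -> \bar R) :
  measurable_fun setT f -> (forall z, 0 <= f z) ->
  \int[P]_w f (X w, w) = \int[P]_w \int[distribution P X]_x f (x, w).
Proof.
move=> mf f0.
pose idRV : {mfun Omega >-> T2} := HB.pack (idfun : Omega -> T2) (isMeasurableFun.Build _ _ _ _ _ mid).
pose pairRV : {mfun Omega >-> (R * T2)%type} :=
  HB.pack (fun w => (X w, w : T2)) (isMeasurableFun.Build _ _ _ _ _ mpair).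
have -> : \int[P]_w f (X w, w) = \int[distribution P pairRV]_z f z.
  by rewrite ge0_integral_pushforward.
transitivity (\int[distribution P X \x distribution P idRV]_z f z).
  apply: eq_measure_integral => A mA _; apply/esym.
  apply: (@product_measure_unique _ _ _ _ R (distribution P X) (distribution P idRV) (distribution P pairRV)) => [D B mD mB|//].
  exact: indep_sigma_algebra.
rewrite (fubini_tonelli2 (m1 := distribution P X) (m2 := distribution P idRV))//.
rewrite ge0_integral_pushforward//.
  exact: (measurable_fun_fubini_tonelli_G (m1 := distribution P X)).
by move=> w _; apply: integral_ge0.
Qed.

End IndependentIntegral.

Section GaussianIntegral.
Variable R : realType.
Notation mu := (@lebesgue_measure R).
Local Notation gamma := (normal_prob (0 : R) 1).

(** The Radon-Nikodym derivative of the normal law equals its density almost everywhere, both having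
    the same integral over each measurable set. *)
Lemma integral_normal_prob (f : R -> \bar R) :
  measurable_fun setT f -> (forall x, 0 <= f x)%E ->
  (\int[gamma]_x f x = \int[mu]_x (f x * (normal_pdf 0 1 x)%:E))%E.
Proof.
move=> mf f0.
have dom := normal_prob_dominates (0 : R) 1.
have mpdf : measurable_fun setT (fun x : R => (normal_pdf 0 1 x)%:E).
  by apply/measurable_EFinP; exact: measurable_normal_pdf.
rewrite -(Radon_Nikodym_SigmaFinite.change_of_variables dom f0 measurableT mf).
have RNi := Radon_Nikodym_SigmaFinite.f_integrable dom.
apply: ae_eq_integral => //.
- by apply: emeasurable_funM => //; exact: measurable_int RNi.
- exact: emeasurable_funM.
- apply: ae_eqe_mul2l; apply: integral_ae_eq => //= E _ mE.
  by rewrite -(Radon_Nikodym_SigmaFinite.f_integral dom mE).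
Qed.

(* Completing the square turns the integrand into a multiple of the density of
   the normal law of mean - v / (1 + c) and variance 1 / (1 + c). *)
Lemma integral_normal_prob_exp_quadratic (u v c : R) : 0 < 1 + c ->
  (\int[gamma]_x (expR (- (u + 2 * x * v + x ^+ 2 * c) / 2))%:E =
   ((Num.sqrt (1 + c))^-1 * expR (- (u - v ^+ 2 / (1 + c)) / 2))%:E)%E.
Proof.
move=> c0.
have mq : measurable_fun setT (fun x : R => expR (- (u + 2 * x * v + x ^+ 2 * c) / 2)).
  apply: measurableT_comp => //; apply: measurable_funM => //.
  apply: measurableT_comp => //; apply: measurable_funD; last first.
    by apply: measurable_funM => //; exact: exprn_measurable.
  by apply: measurable_funD => //; apply: measurable_funM => //; exact: measurable_funM.
rewrite integral_normal_prob; last 2 first.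
- exact/measurable_EFinP.
- by move=> x; rewrite lee_fin expR_ge0.
set s := (Num.sqrt (1 + c))^-1; set m := - (v / (1 + c)).
have s0 : 0 < s by rewrite invr_gt0 sqrtr_gt0.
have s2 : s ^+ 2 = (1 + c)^-1 by rewrite exprVn sqr_sqrtr// ltW.
set K := s * expR (- (u - v ^+ 2 / (1 + c)) / 2).
have K0 : 0 <= K by rewrite mulr_ge0 ?expR_ge0// ltW.
transitivity (\int[mu]_x (K%:E * (normal_pdf m s x)%:E))%E.
  apply: eq_integral => x _; rewrite -!EFinM; congr EFin.
  rewrite !normal_pdfE ?oner_eq0 ?gt_eqF//= /normal_peak /normal_fun.
  have -> : expR (- (u + 2 * x * v + x ^+ 2 * c) / 2) =
     expR (- (u - v ^+ 2 / (1 + c)) / 2) * expR (- (x - m) ^+ 2 / (s ^+ 2 *+ 2))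
       / expR (- (x - 0) ^+ 2 / (1 ^+ 2 *+ 2)).
    rewrite -expRN -!expRD; congr expR; rewrite s2 /m.
    by field; rewrite gt_eqF.
  have -> : (Num.sqrt (s ^+ 2 * pi *+ 2))^-1 = s^-1 * (Num.sqrt (1 ^+ 2 * pi *+ 2))^-1.
    rewrite -invfM -[in RHS](ger0_norm (ltW s0)) -sqrtr_sqr -sqrtrM ?sqr_ge0//.
    by rewrite expr1n mul1r -mulrnAr.
  rewrite /K; field.
  rewrite !gt_eqF ?expR_gt0 ?sqrtr_gt0// ?mulrn_wgt0// ?mulr_gt0// ?pi_gt0//.
rewrite ge0_integralZl//.
- by rewrite integral_normal_pdf mule1.
- by apply/measurable_EFinP; exact: measurable_normal_pdf.
- by move=> x _; rewrite lee_fin normal_pdf_ge0.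
Qed.

End GaussianIntegral.

(** * Inverse and determinant under a rank one update *)

Section RankOneUpdate.
Variables (R : realType) (p : nat).
Implicit Types (Q : 'M[R]_p) (a y : 'cV[R]_p).

(** One predicate covers positive ([e = 1]) and negative ([e = -1]) definite forms: the lower tail
    uses the former, the upper tail the latter. *)
Definition signed_definite (e : R) Q :=
  Q^T = Q /\ forall x : 'cV[R]_p, x != 0 -> 0 < e * ip x (Q *m x).

Lemma signed_definite_unitmx e Q : signed_definite e Q -> Q \in unitmx.
Proof.
case=> Qs Qd; rewrite -row_free_unit -kermx_eq0; apply/eqP/row_matrixP => i.
rewrite row0; set u := row i _; apply/eqP; apply: contraT => u0.
have uQ : u *m Q = 0 by apply/sub_kermxP; exact: row_sub.
have ut0 : u^T != 0 by rewrite -sqn_eq0 sqn_tr sqn_eq0.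
have Qut : Q *m u^T = 0 by rewrite -[Q]trmxK -trmx_mul Qs uQ trmx0.
by have := Qd u^T ut0; rewrite Qut /ip mulmx0 mxtrace0 mulr0 ltxx.
Qed.

Variables (e : R) (Q : 'M[R]_p) (a : 'cV[R]_p).
Hypotheses (Qd : signed_definite e Q) (Qd' : signed_definite e (Q + a *m a^T)).

Let b := invmx Q *m a.
Let c := ip a b.
Let Qu : Q \in unitmx. Proof. exact: signed_definite_unitmx Qd. Qed.
Let Qu' : Q + a *m a^T \in unitmx. Proof. exact: signed_definite_unitmx Qd'. Qed.
Let Qb : Q *m b = a. Proof. by rewrite /b mulmxA mulmxV// mul1mx. Qed.

Let scalar_ip (x y : 'cV[R]_p) : x^T *m y = (ip x y)%:M.
Proof. by rewrite [LHS]mx11_scalar /ip /mxtrace big_ord1. Qed.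

(* With t = <a, b>, the form of Q at b is t and that of Q + a a^T is t (1 + t);
   both have the sign of e. *)
Lemma rank_one_update_gt0 : 0 < 1 + c.
Proof.
have [b0|b0] := eqVneq b 0; first by rewrite /c b0 /ip mulmx0 mxtrace0 addr0.
have h1 : 0 < e * c by rewrite /c -{1}Qb ip_mull Qd.1; exact: (Qd.2 b b0).
have h2 := Qd'.2 b b0.
have ab : ip b a = c by rewrite ipC.
have h3 : ip b ((Q + a *m a^T) *m b) = c * (1 + c).
  rewrite mulmxDl Qb -mulmxA scalar_ip mul_mx_scalar ipDr ipZr ab -/c.
  by rewrite mulrDr mulr1.
by move: h2; rewrite h3 mulrA pmulr_rgt0.
Qed.

(** The Sherman-Morrison formula. *)
Lemma invmx_rank_one_update :
  invmx (Q + a *m a^T) = invmx Q - (1 + c)^-1 *: (b *m b^T).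
Proof.
have c0 : 1 + c != 0 by rewrite gt_eqF// rank_one_update_gt0.
apply: (can_inj (mulKmx Qu')); rewrite mulmxV// mulmxBr mulmxDl mulmxV//.
have bT : b^T = a^T *m invmx Q by rewrite /b trmx_mul trmx_inv Qd.1.
rewrite -mulmxA -bT -scalemxAr mulmxDl mulmxA Qb -mulmxA (mulmxA a^T).
rewrite scalar_ip mul_scalar_mx -scalemxAr -/c -[X in X + c *: _]scale1r -scalerDl.
by rewrite scalerA mulVf// scale1r addrK.
Qed.

(** The right-hand side has the shape [u - v^2 / (1 + c)] left by integrating out one Gaussian
    variable. *)
Lemma quadratic_rank_one_update (y : 'cV[R]_p) :
  ip y (invmx (Q + a *m a^T) *m y) =
  ip y (invmx Q *m y) - ip a (invmx Q *m y) ^+ 2 / (1 + c).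
Proof.
rewrite invmx_rank_one_update mulmxBl -scalemxAl -mulmxA scalar_ip mul_mx_scalar.
have -> : ip a (invmx Q *m y) = ip b y by rewrite /b ip_mull trmx_inv Qd.1.
rewrite ipDr -scaleN1r !ipZr (ipC y b); ring.
Qed.

(** The matrix determinant lemma, from two block triangular factorizations of the same bordered
    matrix. *)
Lemma det_rank_one_update : \det (Q + a *m a^T) = \det Q * (1 + c).
Proof.
have -> : Q + a *m a^T = Q *m (1%:M + b *m a^T).
  by rewrite mulmxDr mulmx1 mulmxA Qb.
rewrite det_mulmx; congr (_ * _).
have h1 : block_mx (1%:M : 'M[R]_1) (- a^T) b 1%:M =
    block_mx 1%:M 0 b 1%:M *m block_mx 1%:M (- a^T) 0 (1%:M + b *m a^T).
  rewrite mulmx_block ?mul1mx ?mulmx1 ?mul0mx ?mulmx0 !addr0 mulmxN.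
  by rewrite addrCA addNr addr0.
have h2 : block_mx (1%:M : 'M[R]_1) (- a^T) b 1%:M =
    block_mx (1 + c)%:M (- a^T) 0 1%:M *m block_mx 1%:M 0 b 1%:M.
  rewrite mulmx_block ?mul1mx ?mulmx1 ?mul0mx ?mulmx0 !add0r mulNmx.
  rewrite scalar_ip -/c -raddfB /=; congr (block_mx _%:M _ _ _).
  by rewrite addrK.
have := congr1 determinant h1; rewrite {1}h2 !det_mulmx !det_lblock !det_ublock.
by rewrite !det1 !mulr1 !mul1r det_scalar1 => ->.
Qed.

End RankOneUpdate.

Section GaussianQuadraticForm.
Variables (d : measure_display) (Omega : measurableType d) (R : realType).
Variables (P : probability Omega R) (I : finType) (G : I -> {RV P >-> R}).
Hypothesis Gi : mutually_independent G.
Hypothesis Gn : forall i, standard_normal (G i).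

(** The cylinder events in the variables indexed by [J], a pi-system for [integral_indep]. *)
Definition boxes (J : {set I}) : set (set Omega) :=
  [set B | exists2 S : I -> set R, (forall i, measurable (S i)) &
    B = [set w | forall i, i \in J -> S i (G i w)]].

Lemma boxes_measurable J : boxes J `<=` measurable.
Proof.
move=> _ [S mS ->].
have -> : [set w | forall i, i \in J -> S i (G i w)] =
    \bigcap_(i in [set` J]) (G i @^-1` S i).
  by apply/seteqP; split => w h i iJ; exact: h.
apply: fin_bigcap_measurable => // i _.
by rewrite -[X in measurable X]setTI; exact: measurable_funP.
Qed.

Lemma boxes_setI J : setI_closed (boxes J).
Proof.
move=> _ _ [S mS ->] [S' mS' ->]; exists (fun i => S i `&` S' i).
  by move=> i; exact: measurableI.
apply/seteqP; split => [w [h h'] i iJ|w h].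
  by split; [exact: h|exact: h'].
by split => i iJ; have [] := h i iJ.
Qed.

Lemma boxes_setT J : boxes J setT.
Proof. by exists (fun=> setT) => //; apply/seteqP. Qed.

Lemma boxes_indep (J : {set I}) k A B : k \notin J -> measurable A -> boxes J B ->
  (P (G k @^-1` A `&` B) = P (G k @^-1` A) * P B)%E.
Proof.
move=> kJ mA [S mS ->].
pose S' i := if i == k then A else S i.
have mS' i : measurable (S' i) by rewrite /S'; case: ifP.
have SS' i : i \in J -> S' i = S i.
  by move=> iJ; rewrite /S'; case: eqP => // ik; rewrite -ik iJ in kJ.
have -> : G k @^-1` A `&` [set w | forall i, i \in J -> S i (G i w)] =
    [set w | forall i, i \in k |: J -> S' i (G i w)].
  apply/seteqP; split => [w [Aw h] i|w h].
    by rewrite in_setU1 => /predU1P[->|iJ]; [rewrite /S' eqxx|rewrite SS'//; exact: h].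
  split => [|i iJ]; first by have := h k (setU11 _ _); rewrite /S' eqxx.
  by rewrite -SS'//; apply: h; rewrite in_setU1 iJ orbT.
rewrite Gi// Gi// big_setU1//= /S' eqxx; congr (_ * _)%E.
apply: eq_bigr => i iJ; case: eqP => // ik.
by rewrite -ik iJ in kJ.
Qed.

Lemma measurable_box (J : {set I}) i : i \in J ->
  measurable_fun setT (G i : g_sigma_algebraType (boxes J) -> R).
Proof.
move=> iJ _ B mB; rewrite setTI; apply: sub_sigma_algebra.
exists (fun j => if j == i then B else setT) => [j|]; first by case: ifP.
apply/seteqP; split => [w Bw j _|w h]; last by have := h i iJ; rewrite eqxx.
by case: eqP => [->|].
Qed.

Variables (p : nat) (a : I -> 'cV[R]_p).

Definition gsum (J : {set I}) (w : Omega) : 'cV[R]_p := \sum_(i in J) G i w *: a i.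

Lemma gsum_entry J i :
  (fun w => gsum J w i 0) = (fun w => \sum_j if j \in J then G j w * a j i 0 else 0).
Proof.
apply/funext => w; rewrite /gsum summxE big_mkcond.
by apply: eq_bigr => j _; case: ifP => // _; rewrite mxE.
Qed.

Lemma measurable_ip d' (T : measurableType d') q (c : 'cV[R]_q) (f : T -> 'cV[R]_q) :
  (forall i, measurable_fun setT (fun w => f w i 0)) ->
  measurable_fun setT (fun w => ip c (f w)).
Proof.
move=> mf; under eq_fun do rewrite ipE.
apply: measurable_sum => i; under eq_fun do rewrite big_ord1.
by apply: measurable_funM => //; exact: mf.
Qed.

Lemma measurable_quadratic d' (T : measurableType d') q (A : 'M[R]_q) (f : T -> 'cV[R]_q) :
  (forall i, measurable_fun setT (fun w => f w i 0)) ->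
  measurable_fun setT (fun w => ip (f w) (A *m f w)).
Proof.
move=> mf; under eq_fun do rewrite ipE.
apply: measurable_sum => i; under eq_fun do rewrite big_ord1.
apply: measurable_funM; first exact: mf.
under eq_fun do rewrite mxE.
by apply: measurable_sum => j; apply: measurable_funM => //; exact: mf.
Qed.

Lemma measurable_gsum_box (J : {set I}) i :
  measurable_fun setT (fun w : g_sigma_algebraType (boxes J) => gsum J w i 0).
Proof.
rewrite gsum_entry; apply: measurable_sum => j; case: (boolP (j \in J)) => jJ //.
by apply: measurable_funM => //; exact: measurable_box.
Qed.


Lemma integral_standard_normal (X : {RV P >-> R}) (f : R -> \bar R) :
  standard_normal X -> measurable_fun setT f -> (forall x, 0 <= f x)%E ->
  (\int[distribution P X]_x f x = \int[normal_prob (0 : R) 1]_x f x)%E.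
Proof.
move=> Xn mf f0.
have mid : measurable_fun setT (idfun : measurableTypeR R -> R).
  by move=> _ B mB; rewrite setTI.
pose idR : {mfun measurableTypeR R >-> R} :=
  HB.pack (idfun : measurableTypeR R -> R) (isMeasurableFun.Build _ _ _ _ _ mid).
transitivity (\int[distribution (normal_prob (0 : R) 1) idR]_x f x)%E.
  by apply: eq_measure_integral => A mA _; exact: Xn.
by rewrite ge0_integral_pushforward.
Qed.

(** Induction on the size of [J]. Integrating out [G k] by completing the square replaces [Q] by
    [Q + a_k a_k^T] and leaves a factor [1 / sqrt (1 + c)], where [1 + c] is the ratio of the two
    determinants. Definiteness for every subset of [J] keeps [1 + c] positive at each stage. *)
Lemma integral_exp_gsum e (J : {set I}) (Q : 'M[R]_p) :
  (forall K : {set I}, K \subset J ->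
     signed_definite e (Q + \sum_(i in K) a i *m (a i)^T)) ->
  (\int[P]_w (expR (- ip (gsum J w) (invmx Q *m gsum J w) / 2))%:E =
   ((Num.sqrt (\det (Q + \sum_(i in J) a i *m (a i)^T) / \det Q))^-1)%:E)%E.
Proof.
have [N] := ubnP #|J|; elim: N => // N ih in J Q *; rewrite ltnS => JN Jd.
have Qd : signed_definite e Q.
  by have := Jd finset.set0 (finset.sub0set _); rewrite big_set0 addr0.
have detQ : \det Q != 0.
  by rewrite -unitfE -[_ \is a _]/(Q \in unitmx); exact: signed_definite_unitmx Qd.
have [->|[k kJ]] := set_0Vmem J.
  rewrite big_set0 addr0 divff// sqrtr1 invr1.
  transitivity (\int[P]_w (cst 1 w))%E; last by rewrite integral_cst//= probability_setT mule1.
  apply: eq_integral => w _; rewrite /gsum big_set0 mulmx0 /ip mulmx0 mxtrace0.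
  by rewrite oppr0 mul0r expR0.
set J1 := J :\ k; have kJ1 : k \notin J1 by rewrite !inE eqxx.
have JE : J = k |: J1 by rewrite finset.setD1K.
set Q' := Q + a k *m (a k)^T.
have Qd' : signed_definite e Q'.
  by have := Jd [set k]%SET; rewrite finset.sub1set kJ big_set1; exact.
have Jd1 (K : {set I}) : K \subset J1 ->
    signed_definite e (Q' + \sum_(i in K) a i *m (a i)^T).
  move=> KJ1; have kK : k \notin K by apply: contra kJ1; exact: (fintype.subsetP KJ1 k).
  have := Jd (k |: K); rewrite big_setU1// addrA; apply.
  by rewrite finset.subUset finset.sub1set kJ (fintype.subset_trans KJ1)// finset.subD1set.
have J1N : (#|J1| < N)%N by rewrite (cardsD1 k J) kJ in JN.
pose v w := ip (a k) (invmx Q *m gsum J1 w).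
pose u w := ip (gsum J1 w) (invmx Q *m gsum J1 w).
pose c := ip (a k) (invmx Q *m a k).
have c0 : 0 < 1 + c by exact: (rank_one_update_gt0 Qd Qd').
have gsumE w : gsum J w = gsum J1 w + G k w *: a k.
  by rewrite /gsum {1}JE big_setU1//= addrC.
have uvE w : ip (gsum J w) (invmx Q *m gsum J w)
    = u w + 2 * G k w * v w + G k w ^+ 2 * c.
  rewrite gsumE mulmxDr -scalemxAr !ipDr !ipDl !ipZl !ipZr.
  have -> : ip (gsum J1 w) (invmx Q *m a k) = v w.
    by rewrite /v ipC ip_mull trmx_inv Qd.1.
  by rewrite -/(u w) -/(v w) -/c; ring.
pose T2 := g_sigma_algebraType (boxes J1).
pose f (z : R * T2) : \bar R :=
  (expR (- (u z.2 + 2 * z.1 * v z.2 + z.1 ^+ 2 * c) / 2))%:E.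
have mv : measurable_fun setT (v : T2 -> R).
  rewrite /v; under eq_fun do rewrite -[invmx Q]trmxK -ip_mull.
  by apply: measurable_ip; exact: measurable_gsum_box.
have mu : measurable_fun setT (u : T2 -> R).
  by apply: measurable_quadratic; exact: measurable_gsum_box.
have mf : measurable_fun setT f.
  apply/measurable_EFinP; apply: measurableT_comp => //.
  apply: measurable_funM => //; apply: measurableT_comp => //.
  apply: measurable_funD; last first.
    apply: measurable_funM => //; apply: measurable_funX.
    exact: measurable_fst.
  apply: measurable_funD.
    by apply: (measurableT_comp mu); exact: measurable_snd.
  apply: measurable_funM.
    by apply: measurable_funM => //; exact: measurable_fst.
  by apply: (measurableT_comp mv); exact: measurable_snd.
transitivity (\int[P]_w f (G k w, w))%E.
  by apply: eq_integral => w _; rewrite /f uvE.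
rewrite (integral_indep (@boxes_measurable J1) (@boxes_setI J1) (@boxes_setT J1)
  (fun A B => @boxes_indep J1 k A B kJ1) mf); last first.
  by move=> z; rewrite lee_fin expR_ge0.
transitivity (\int[P]_w ((Num.sqrt (1 + c))^-1%:E *
    (expR (- ip (gsum J1 w) (invmx Q' *m gsum J1 w) / 2))%:E))%E.
  apply: eq_integral => w _.
  transitivity (\int[normal_prob (0 : R) 1]_x f (x, w))%E.
    apply: integral_standard_normal => [//||x]; last by rewrite lee_fin expR_ge0.
    apply: (measurableT_comp mf (g := fun x : R => (x, w : T2))).
    exact: measurable_fun_pair.
  rewrite /f /= integral_normal_prob_exp_quadratic// EFinM.
  by rewrite (quadratic_rank_one_update Qd Qd').
have mG1 i : measurable_fun setT (fun w => gsum J1 w i 0).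
  rewrite gsum_entry; apply: measurable_sum => j; case: (boolP (j \in J1)) => jJ //.
  by apply: measurable_funM => //; exact: measurable_funP.
rewrite ge0_integralZl//; last first.
  apply/measurable_EFinP; apply: measurableT_comp => //.
  apply: measurable_funM => //; apply: measurableT_comp => //.
  exact: measurable_quadratic.
rewrite ih// -EFinM -invfM -sqrtrM ?ltW//; congr (Num.sqrt _)^-1%:E.
have -> : Q + \sum_(i in J) a i *m (a i)^T = Q' + \sum_(i in J1) a i *m (a i)^T.
  by rewrite JE big_setU1//= addrA.
rewrite /Q' (det_rank_one_update (a k) Qd) -/Q' -/c.
by field; rewrite detQ gt_eqF.
Qed.

End GaussianQuadraticForm.

(** * Tail bounds for a fixed vector *)

Section GaussianTails.
Variables (d : measure_display) (Omega : measurableType d) (R : realType).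
Variables (P : probability Omega R) (r n p : nat).
Variables (G : 'I_r -> 'I_n -> {RV P >-> R}) (K : 'M[R]_(n, p)).
Hypotheses (hG : gaussian_mx G) (Ko : orthonormal_cols K).

Definition sketch_rv (w : Omega) : 'M[R]_(r, p) := random_mx G w *m K.

Lemma measurable_random_mx i j : measurable_fun setT (fun w => random_mx G w i j).
Proof. by under eq_fun do rewrite mxE; exact: measurable_funP. Qed.

Lemma measurable_sketch_rv i j : measurable_fun setT (fun w => sketch_rv w i j).
Proof.
under eq_fun do rewrite mxE.
apply: measurable_sum => k; apply: measurable_funM => //.
exact: measurable_random_mx.
Qed.

Lemma measurable_sqn_sketch (z : 'cV[R]_r) :
  measurable_fun setT (fun w => sqn ((sketch_rv w)^T *m z)).
Proof.
under eq_fun do rewrite sqnE.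
apply: measurable_sum => i; under eq_fun do rewrite big_ord1.
apply: measurable_funX; under eq_fun do rewrite mxE.
apply: measurable_sum => j; apply: measurable_funM => //.
under eq_fun do rewrite mxE.
exact: measurable_sketch_rv.
Qed.

Section UnitVector.
Variable x : 'cV[R]_r.
Hypothesis x1 : sqn x = 1.

(** These are the coefficients of [(G K)^T x] as a linear combination of the entries of [G]. Their
    outer products sum to the identity because [x] is a unit vector and [K] has orthonormal
    columns. *)
Let a (ij : 'I_r * 'I_n) : 'cV[R]_p := x ij.1 0 *: (row ij.2 K)^T.
Let G' (ij : 'I_r * 'I_n) := G ij.1 ij.2.

Let gsum_sketch w : gsum G' a [set: 'I_r * 'I_n]%SET w = (sketch_rv w)^T *m x.
Proof.
apply/matrixP => k j; rewrite ord1 /gsum summxE big_mkcond /= mxE.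
rewrite (eq_bigr (fun ij => random_mx G w ij.1 ij.2 * K ij.2 k * x ij.1 0)); last first.
  by move=> ij _; rewrite inE !mxE /G'; ring.
rewrite -(pair_bigA _ (fun i j => random_mx G w i j * K j k * x i 0)) /=.
by apply: eq_bigr => i _; rewrite !mxE mulr_suml.
Qed.

Let sum_outer (J : {set 'I_r * 'I_n}) (y : 'cV[R]_p) :
  ip y ((\sum_(ij in J) a ij *m (a ij)^T) *m y) = \sum_(ij in J) ip (a ij) y ^+ 2.
Proof.
rewrite mulmx_suml /ip mulmx_sumr raddf_sum /=; apply: eq_bigr => ij _.
rewrite -/(ip y _) ipC -mulmxA ip_mull -/(sqn _) sqnE !big_ord1.
by rewrite -trace_mx11.
Qed.

Let sum_outer_all : \sum_(ij in [set: 'I_r * 'I_n]%SET) a ij *m (a ij)^T = 1%:M.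
Proof.
rewrite -Ko; apply/matrixP => k l; rewrite summxE big_mkcond /=.
rewrite (eq_bigr (fun ij => x ij.1 0 ^+ 2 * (K ij.2 k * K ij.2 l))); last first.
  by move=> ij _; rewrite inE mxE big_ord1 !mxE; ring.
rewrite -(pair_bigA _ (fun i j => x i 0 ^+ 2 * (K j k * K j l))) /=.
under eq_bigr do rewrite -mulr_sumr.
rewrite -mulr_suml (_ : \sum_i x i 0 ^+ 2 = 1) ?mul1r.
  by rewrite mxE; apply: eq_bigr => j _; rewrite mxE.
by rewrite -x1 sqnE; apply: eq_bigr => i _; rewrite big_ord1.
Qed.

(** Partial sums of the outer products lie between 0 and the identity, so adding [t] gives a
    positive form for [t > 0] and a negative one for [t < -1]. *)
Let definite (e t : R) : e = 1 /\ 0 < t \/ e = -1 /\ t < -1 ->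
  forall J : {set 'I_r * 'I_n}, signed_definite e (t%:M + \sum_(ij in J) a ij *m (a ij)^T).
Proof.
move=> et J; split.
  rewrite linearD /= tr_scalar_mx raddf_sum /=; congr (_ + _).
  by apply: eq_bigr => ij _; rewrite trmx_mul trmxK.
move=> y y0; rewrite mulmxDl mul_scalar_mx ipDr ipZr sum_outer -/(sqn y).
have y1 : 0 < sqn y by rewrite sqn_gt0.
set s := \sum_(_ in J) _.
have s0 : 0 <= s by apply: sumr_ge0 => ij _; exact: sqr_ge0.
have sy : s <= sqn y.
  rewrite /sqn -[X in ip y X]mul1mx -sum_outer_all sum_outer [leRHS](bigID (fun ij => ij \in J)) /=.
  rewrite [X in X + _](eq_bigl (fun ij => ij \in J)); last by move=> ij; rewrite inE.
  by rewrite lerDl sumr_ge0// => ij _; exact: sqr_ge0.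
case: et => -[-> ht]; last by nra.
by rewrite mul1r ltr_pwDl// mulr_gt0.
Qed.

(** The Laplace transform of a chi-squared variable with [p] degrees of freedom, at the parameter
    [1 / (2 t)]. *)
Lemma integral_exp_sketch (e t : R) : e = 1 /\ 0 < t \/ e = -1 /\ t < -1 ->
  (\int[P]_w (expR (- (t^-1 * sqn ((sketch_rv w)^T *m x)) / 2))%:E =
   ((Num.sqrt (((t + 1) / t) ^+ p))^-1)%:E)%E.
Proof.
move=> et; have t0 : t != 0 by case: et => -[_]; [move/gt_eqF->|move=> h; rewrite lt_eqF//; lra].
have [Gi Gn] := hG.
have := integral_exp_gsum (Gi : mutually_independent G') (fun ij => Gn ij.1 ij.2)
  (J := [set: 'I_r * 'I_n]%SET) (a := a) (Q := t%:M) (e := e) (fun J _ => definite et J).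
rewrite sum_outer_all -raddfD /= !det_scalar -expr_div_n => <-.
apply: eq_integral => w _; rewrite gsum_sketch invmx_scalar mul_scalar_mx ipZr.
by [].
Qed.

End UnitVector.

Lemma markov_ge1 (f : Omega -> R) (A : set Omega) : measurable A ->
  measurable_fun setT f -> (forall w, 0 <= f w) -> (forall w, A w -> 1 <= f w) ->
  (P A <= \int[P]_w (f w)%:E)%E.
Proof.
move=> mA mf f0 f1; rewrite -[A]setIT -integral_indic//.
apply: ge0_le_integral => //.
- by apply/measurable_EFinP.
- by apply/measurable_EFinP.
- move=> w _; rewrite lee_fin indicE; have [wA|_] := boolP (w \in A) => //=.
  by apply: f1; exact/set_mem.
Qed.

Lemma measurable_sqn_sketch_ge (z : 'cV[R]_r) (c : R) :
  measurable [set w | c <= sqn ((sketch_rv w)^T *m z)].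
Proof.
rewrite -[X in measurable X]setTI; apply: measurable_fun_le => //.
exact: measurable_sqn_sketch.
Qed.

Lemma measurable_sqn_sketch_le (z : 'cV[R]_r) (c : R) :
  measurable [set w | sqn ((sketch_rv w)^T *m z) <= c].
Proof.
rewrite -[X in measurable X]setTI; apply: measurable_fun_le => //.
exact: measurable_sqn_sketch.
Qed.

Let normalize (z : 'cV[R]_r) : z != 0 -> exists2 x : 'cV[R]_r, sqn x = 1 &
  forall A : 'M[R]_(p, r), sqn (A *m z) = sqn z * sqn (A *m x).
Proof.
move=> z0; have z1 : 0 < sqn z by rewrite sqn_gt0.
have zx : sqn z *  (frob_norm z)^-1 ^+ 2 = 1.
  by rewrite exprVn sqr_frob_norm divff// gt_eqF.
exists ((frob_norm z)^-1 *: z) => [|A]; first by rewrite sqnZ mulrC.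
by rewrite -scalemxAr sqnZ mulrA zx mul1r.
Qed.

(** Markov's inequality for [exp (- 3 s / 2)], where [s] is the squared norm at a unit vector:
    [t = 1 / 3] makes the expectation [2 ^- p], and the threshold contributes
    [3 / 2 * 18 / 100 = 27 / 100]. *)
Lemma sketch_lower_tail (z : 'cV[R]_r) : z != 0 ->
  (P [set w | (sqn ((sketch_rv w)^T *m z) <= 18 / 100 * p%:R * sqn z)%R]
   <= (expR (27 / 100 * p%:R) / 2 ^+ p)%:E)%E.
Proof.
move=> z0; have [x x1 zx] := normalize z0.
have z1 : 0 < sqn z by rewrite sqn_gt0.
pose f w := expR (27 / 100 * p%:R) * expR (- (3^-1^-1 * sqn ((sketch_rv w)^T *m x)) / 2).
have mf : measurable_fun setT (fun w => expR (- (3^-1^-1 * sqn ((sketch_rv w)^T *m x)) / 2)).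
  apply: measurableT_comp => //; apply: measurable_funM => //.
  apply: measurableT_comp => //; apply: measurable_funM => //.
  exact: measurable_sqn_sketch.
apply: le_trans (@markov_ge1 f _ _ _ _ _) _.
- exact: measurable_sqn_sketch_le.
- exact: measurable_funM.
- by move=> w; rewrite mulr_ge0 ?expR_ge0.
- move=> w /=; rewrite zx mulrC ler_pM2r// => h; rewrite /f -expRD -[leLHS]expR0 ler_expR invrK.
  by lra.
under eq_integral do rewrite EFinM.
rewrite ge0_integralZl//; last exact/measurable_EFinP.
rewrite (@integral_exp_sketch x x1 1); last by left; split; rewrite ?invr_gt0.
rewrite -EFinM lee_fin (_ : (3^-1 + 1) / 3^-1 = 2 ^+ 2); last by field.
by rewrite -exprM mulnC exprM sqrtr_sqr ger0_norm ?exprn_ge0.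
Qed.

(** Markov's inequality for [exp (s / 4)]: [t = -2] makes the expectation the square root of
    [2 ^ p], and the threshold [2 p] contributes [exp (- p / 2)]. *)
Lemma sketch_upper_tail (z : 'cV[R]_r) : z != 0 ->
  (P [set w | (2 * p%:R * sqn z <= sqn ((sketch_rv w)^T *m z))%R]
   <= (expR (- (p%:R / 2)) * Num.sqrt (2 ^+ p))%:E)%E.
Proof.
move=> z0; have [x x1 zx] := normalize z0.
have z1 : 0 < sqn z by rewrite sqn_gt0.
pose f w := expR (- (p%:R / 2)) * expR (- ((- 2)^-1 * sqn ((sketch_rv w)^T *m x)) / 2).
have mf : measurable_fun setT (fun w => expR (- ((- 2)^-1 * sqn ((sketch_rv w)^T *m x)) / 2)).
  apply: measurableT_comp => //; apply: measurable_funM => //.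
  apply: measurableT_comp => //; apply: measurable_funM => //.
  exact: measurable_sqn_sketch.
apply: le_trans (@markov_ge1 f _ _ _ _ _) _.
- exact: measurable_sqn_sketch_ge.
- exact: measurable_funM.
- by move=> w; rewrite mulr_ge0 ?expR_ge0.
- move=> w /=; rewrite zx mulrC ler_pM2l// => h; rewrite /f -expRD -[leLHS]expR0 ler_expR.
  by rewrite invrN; lra.
under eq_integral do rewrite EFinM.
rewrite ge0_integralZl//; last exact/measurable_EFinP.
rewrite (@integral_exp_sketch x x1 (-1)); last by right; split => //; lra.
rewrite -EFinM lee_fin (_ : (- 2 + 1) / (- 2) = 2^-1); last by field.
by rewrite exprVn sqrtrV ?exprn_ge0// invrK.
Qed.

End GaussianTails.

(** * Extreme singular values of Gaussian matrices *)

Section IntegerNet.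
Variable R : realType.

(** The second bound controls the change of a quadratic form when one coordinate moves from [t] to
    [z]: [g] is the entry of [F v] there and [h] the diagonal entry of [F]. *)
Lemma round_coordinate (t g h T : R) : 0 <= T -> h <= T ->
  exists z : int, `|z%:~R - t| <= 1 /\
    2 * (z%:~R - t) * g + (z%:~R - t) ^+ 2 * h <= T / 4.
Proof.
move=> T0 hT; set f := Num.floor t; set th := t - f%:~R.
have th0 : 0 <= th by rewrite subr_ge0 floor_le.
have th1 : th < 1 by have := floorD1_gt t; rewrite intrD -/f /th; lra.
have e1 : f%:~R - t = - th by rewrite /th opprB.
have e2 : (f + 1)%:~R - t = 1 - th by rewrite intrD /th; lra.
have [le1|gt1] := leP (2 * (- th) * g + (- th) ^+ 2 * h) (T / 4).
  by exists f; rewrite e1 normrN ger0_norm// ltW.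
have [le2|gt2] := leP (2 * (1 - th) * g + (1 - th) ^+ 2 * h) (T / 4).
  exists (f + 1); rewrite e2 ger0_norm; last by rewrite subr_ge0 ltW.
  by rewrite gerBl.
(* The two roundings, weighted by 1 - th and th, have mean zero and variance
   th (1 - th) <= 1 / 4. *)
exfalso.
have avg : (1 - th) * (2 * (- th) * g + (- th) ^+ 2 * h)
    + th * (2 * (1 - th) * g + (1 - th) ^+ 2 * h) = th * (1 - th) * h by ring.
have var : th * (1 - th) * h <= T / 4.
  have v0 : 0 <= th * (1 - th) by rewrite mulr_ge0// subr_ge0 ltW.
  have v1 : th * (1 - th) <= 1 / 4 by have := sqr_ge0 (th - 1 / 2); nra.
  by nra.
move: avg var gt1 gt2; set A := 2 * _ * g + _; set B := 2 * _ * g + _ => avg var gt1 gt2.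
by nra.
Qed.

(** Coordinates are rounded one at a time. Each move is judged at the current, partly rounded vector
    and costs at most [T / 4]. *)
Lemma round_quadratic r (F : 'M[R]_r) (T : R) (y : 'cV[R]_r) :
  F^T = F -> 0 <= T -> (forall i, F i i <= T) ->
  exists z : 'I_r -> int, (forall i, `|(z i)%:~R - y i 0| <= 1) /\
    let v := \col_i (z i)%:~R in ip v (F *m v) <= ip y (F *m y) + r%:R * (T / 4).
Proof.
move=> Fs T0 FT.
suff h (s : seq 'I_r) : uniq s -> exists (v : 'cV[R]_r) (z : 'I_r -> int),
    [/\ forall i, `|(z i)%:~R - y i 0| <= 1,
      forall i, i \in s -> v i 0 = (z i)%:~R, forall i, i \notin s -> v i 0 = y i 0
    & ip v (F *m v) <= ip y (F *m y) + (size s)%:R * (T / 4)].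
  have [v [z [zy vz _ vF]]] := h _ (enum_uniq 'I_r); exists z; split=> //=.
  have <- : v = \col_i (z i)%:~R.
    by apply/matrixP => i j; rewrite ord1 mxE vz// mem_enum.
  by move: vF; rewrite -cardE card_ord.
elim: s => [_|i s ih /= /andP[si us]].
  exists y, (fun i => Num.floor (y i 0)); split=> //; last by rewrite mul0r addr0.
  move=> i; have h1 := floor_le (y i 0); have h2 := floorD1_gt (y i 0).
  by rewrite intrD in h2; rewrite ler_norml; lra.
have [v [z [zy vz vy vF]]] := ih us.
have [k [k1 k2]] := round_coordinate (y i 0) ((F *m v) i 0) T0 (FT i).
set t := k%:~R - y i 0 in k1 k2.
exists (v + t *: delta_mx i 0), (fun j => if j == i then k else z j); split.
- by move=> j; case: eqP => [->|_].
- move=> j; rewrite inE !mxE eqxx andbT; case: eqP => [-> _|ji /= js].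
    by rewrite (vy i)// /t mulr1 addrC subrK.
  by rewrite mulr0 addr0 vz.
- move=> j; rewrite inE negb_or !mxE => /andP[/negbTE -> js].
  by rewrite mulr0 addr0 vy.
have de (u : 'cV[R]_r) : ip (delta_mx i 0) u = u i 0.
  rewrite ipE (bigD1 i)//= big_ord1 mxE !eqxx mul1r big1 ?addr0// => j ji.
  by rewrite big_ord1 mxE (negbTE ji) mul0r.
have -> : ip (v + t *: delta_mx i 0) (F *m (v + t *: delta_mx i 0)) =
    ip v (F *m v) + (2 * t * (F *m v) i 0 + t ^+ 2 * F i i).
  rewrite mulmxDr -scalemxAr !ipDr !ipDl !ipZr !ipZl !de.
  have -> : ip v (F *m delta_mx i 0) = (F *m v) i 0.
    by rewrite -[F in LHS]Fs -ip_mull ipC de.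
  by rewrite -colE !mxE; ring.
rewrite -[(size s).+1]addn1 natrD [(_ + _) * (T / 4)]mulrDl mul1r [leRHS]addrA.
exact: lerD.
Qed.

(** Integer vectors with entries in [[-3 r, 3 r]], offset by [3 r] so that a finite type indexes
    them; [net] keeps those of l1 norm at most [3 r]. *)
Definition net_point r (f : {ffun 'I_r -> 'I_(6 * r).+1}) : 'cV[R]_r :=
  \col_i ((f i)%:R - (3 * r)%:R).

(** The distance [|k - 3 r|]: at least one of the two truncated differences is zero. *)
Definition net_dist r (k : nat) : nat := (k - 3 * r) + (3 * r - k).

Definition net r : {set {ffun 'I_r -> 'I_(6 * r).+1}} :=
  [set f : {ffun 'I_r -> 'I_(6 * r).+1} | (\sum_i net_dist r (f i) <= 3 * r)%N]%SET.

Lemma net_distE r k : (net_dist r k)%:R = `|k%:R - (3 * r)%:R| :> R.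
Proof.
rewrite /net_dist; have [h|h] := leqP (3 * r) k.
  by rewrite (eqP h) addn0 natrB// ger0_norm// subr_ge0 ler_nat.
have h' := ltnW h; have /eqP -> : (k - 3 * r == 0)%N by rewrite subn_eq0.
by rewrite add0n natrB// distrC ger0_norm// subr_ge0 ler_nat.
Qed.

Lemma net_quadratic r (F : 'M[R]_r) (T : R) (y : 'cV[R]_r) :
  F^T = F -> 0 <= T -> (forall i, F i i <= T) -> sqn y = (4 * r)%:R ->
  exists2 f, f \in net r & ip (net_point f) (F *m net_point f)
    <= ip y (F *m y) + r%:R * (T / 4).
Proof.
move=> Fs T0 FT yr; have [z [zy zF]] := round_quadratic y Fs T0 FT.
have sz : \sum_i `|(z i)%:~R : R| <= (3 * r)%:R.
  (* Each [|z_i|] is at most [|y_i| + 1 <= 2 + y_i^2 / 4], and these bounds sum to [2 r + r]. *)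
  apply: (@le_trans _ _ (\sum_(i < r) (2 + y i 0 ^+ 2 / 4))).
    apply: ler_sum => i _; have := zy i; have := sqr_ge0 (`|y i 0| - 2).
    rewrite sqrrB real_normK ?num_real// => h1 h2.
    have h3 : `|(z i)%:~R| <= `|y i 0| + 1 :> R.
      rewrite -[X in `|X|](subrK (y i 0)) (le_trans (ler_normD _ _))// addrC.
      by rewrite lerD2l.
    by rewrite -mulr_natr in h1; lra.
  rewrite big_split /= sumr_const card_ord -mulr_suml.
  have -> : \sum_(i < r) y i 0 ^+ 2 = (4 * r)%:R.
    by rewrite -yr sqnE; apply: eq_bigr => i _; rewrite big_ord1.
  by rewrite !natrM -mulr_natr; lra.
have zr i : `|(z i)%:~R| <= (3 * r)%:R :> R.
  apply: le_trans sz; rewrite (bigD1 i)//= lerDl sumr_ge0// => *.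
have zk i : exists k : 'I_(6 * r).+1, (k%:R - (3 * r)%:R = (z i)%:~R :> R).
  have zi : 0 <= (z i + (3 * r)%:Z)%R.
    rewrite -(ler0z R) intrD.
    by have := zr i; rewrite ler_norml => /andP[+ _]; rewrite -pmulrn; lra.
  set q := absz (z i + (3 * r)%:Z)%R.
  have qE : q%:R = (z i)%:~R + (3 * r)%:R :> R.
    by rewrite [LHS]pmulrn /q abszE ger0_norm// intrD.
  have zle : (q < (6 * r).+1)%N.
    rewrite ltnS -(ler_nat R) qE.
    have := zr i; rewrite ler_norml => /andP[_]; rewrite !natrM; lra.
  by exists (Ordinal zle); rewrite /= qE addrK.
have /choice[f hf] := zk.
exists (finfun f).
  rewrite inE -(ler_nat R) natr_sum; apply: le_trans sz.
  by apply: ler_sum => i _; rewrite net_distE ffunE hf.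
have -> : net_point (finfun f) = \col_i (z i)%:~R.
  by apply/matrixP => i j; rewrite !mxE ffunE hf.
exact: zF.
Qed.

Lemma sum_geometric23 k : \sum_(i < k) (2 / 3 : R) ^+ i <= 3.
Proof.
suff -> : \sum_(i < k) (2 / 3 : R) ^+ i = 3 * (1 - (2 / 3) ^+ k).
  have : 0 <= (2 / 3 : R) ^+ k by rewrite exprn_ge0// divr_ge0.
  lra.
elim: k => [|k ih]; first by rewrite big_ord0 expr0 subrr mulr0.
by rewrite big_ord_recr /= ih exprS; field.
Qed.

(* Chernoff's bound for counting: (2/3)^(|z|_1 - 3 r) >= 1 on the net, and its
   sum over all integer points factors over the coordinates. *)
Lemma card_net r : #|net r|%:R <= 17 ^+ r :> R.
Proof.
pose w k : R := (2 / 3) ^+ net_dist r k.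
have w0 k : 0 <= w k by rewrite exprn_ge0// divr_ge0.
have sw : \sum_(k < (6 * r).+1) w k <= 5.
  have e6 : ((6 * r).+1 = 3 * r + (3 * r).+1)%N by lia.
  rewrite e6 big_split_ord /= (reindex_inj rev_ord_inj) /=.
  have -> : \sum_(j < 3 * r) w (3 * r - j.+1)%N = (2 / 3) * \sum_(j < 3 * r) (2 / 3) ^+ j.
    rewrite mulr_sumr; apply: eq_bigr => j _; rewrite -exprS /w /net_dist.
    by congr (_ ^+ _); have := ltn_ord j; lia.
  have -> : \sum_(i < (3 * r).+1) w (3 * r + i)%N = \sum_(i < (3 * r).+1) (2 / 3) ^+ i.
    by apply: eq_bigr => j _; rewrite /w /net_dist; congr (_ ^+ _); lia.
  by have := sum_geometric23 (3 * r); have := sum_geometric23 (3 * r).+1; lra.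
have h : #|net r|%:R * (2 / 3) ^+ (3 * r) <= 5 ^+ r :> R.
  apply: (@le_trans _ _ (\sum_(f : {ffun 'I_r -> 'I_(6 * r).+1}) \prod_i w (f i))).
    rewrite (bigID (fun f => f \in net r)) /= -[leLHS]addr0 lerD//; last first.
      by apply: sumr_ge0 => f _; apply: prodr_ge0.
    rewrite mulr_natl -sumr_const; apply: ler_sum => f; rewrite inE => fn.
    rewrite /w prodrXr; apply: ler_wiXn2l => //; lra.
  rewrite -(bigA_distr_bigA (fun (_ : 'I_r) (k : 'I_(6 * r).+1) => w k)) /= prodr_const card_ord.
  by rewrite lerXn2r ?nnegrE// sumr_ge0.
have q0 : 0 < (2 / 3 : R) ^+ (3 * r) by rewrite exprn_gt0// divr_gt0.
rewrite -(ler_pM2r q0) (le_trans h)// exprM -exprMn.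
by apply: lerXn2r; rewrite ?nnegrE ?exprS ?expr0; lra.
Qed.

End IntegerNet.

Section ExtremeSingularValues.
Variable R : realType.

(** The source of the numerical bounds on the exponential below, used with [k = 8]. *)
Lemma expR_ge_pow (x y : R) k : 0 <= 1 + x -> y = x * k%:R -> (1 + x) ^+ k <= expR y.
Proof.
move=> x0 ->; rewrite expRM_natr lerXn2r ?nnegrE ?expR_ge0//.
exact: expR_ge1Dx.
Qed.

Lemma expR_3_4_ge : 61 / 30 <= expR (3 / 4) :> R.
Proof.
have := @expR_ge_pow (3 / 32) (3 / 4) 8 ltac:(lra) ltac:(lra).
by apply: le_trans; rewrite !exprS expr0; lra.
Qed.

Lemma expR_3_ge17 : 17 <= expR 3 :> R.
Proof.
have -> : 3 = 3 / 4 * 4%:R :> R by lra.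
rewrite expRM_natr; apply: (@le_trans _ _ ((61 / 30) ^+ 4)).
  by rewrite !exprS expr0; lra.
by rewrite lerXn2r ?nnegrE ?expR_ge0 ?expR_3_4_ge//; lra.
Qed.

Lemma expR_13_20_le2 : expR (13 / 20) <= 2 :> R.
Proof.
have := @expR_ge_pow (- (13 / 160)) (- (13 / 20)) 8 ltac:(lra) ltac:(lra).
rewrite expRN => h; rewrite -[leLHS]invrK -[leRHS]invrK lef_pV2 ?posrE ?invr_gt0 ?expR_gt0//.
by apply: le_trans h; rewrite !exprS expr0; lra.
Qed.

Lemma pow2_lower p : expR (13 / 20 * p%:R) <= 2 ^+ p :> R.
Proof. by rewrite expRM_natr lerXn2r ?nnegrE ?expR_ge0 ?expR_13_20_le2. Qed.

Lemma pow2_upper p : 2 ^+ p <= expR (3 / 4 * p%:R) :> R.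
Proof.
rewrite expRM_natr lerXn2r ?nnegrE ?expR_ge0//.
by apply: le_trans expR_3_4_ge; lra.
Qed.

Lemma sqrt_pow2_upper p : Num.sqrt (2 ^+ p) <= expR (3 / 8 * p%:R) :> R.
Proof.
rewrite -[leRHS]ger0_norm ?expR_ge0// -sqrtr_sqr ler_sqrt ?sqr_ge0//.
rewrite -expRM_natr (le_trans (pow2_upper p))// ler_expR.
by lra.
Qed.

Lemma pow17_upper r : 17 ^+ r <= expR (3 * r%:R) :> R.
Proof. by rewrite expRM_natr lerXn2r ?nnegrE ?expR_ge0 ?expR_3_ge17. Qed.

Lemma upper_tail_le p : expR (- (p%:R / 2)) * Num.sqrt (2 ^+ p) <= expR (- (p%:R / 8)) :> R.
Proof.
apply: (@le_trans _ _ (expR (- (p%:R / 2)) * expR (3 / 8 * p%:R))).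
  by rewrite ler_wpM2l ?expR_ge0 ?sqrt_pow2_upper.
by rewrite -expRD ler_expR; lra.
Qed.

Lemma lower_tail_le p : expR (27 / 100 * p%:R) / 2 ^+ p <= expR (- (38 / 100 * p%:R)) :> R.
Proof.
rewrite ler_pdivrMr ?exprn_gt0//.
apply: (@le_trans _ _ (expR (- (38 / 100 * p%:R)) * expR (13 / 20 * p%:R))).
  by rewrite -expRD ler_expR; lra.
by rewrite ler_wpM2l ?expR_ge0 ?pow2_lower.
Qed.

Variables (d : measure_display) (Omega : measurableType d) (P : probability Omega R).

(** An explicit measurable [Bad] is carried along, so that the measurability of uniform statements
    over all vectors never comes up. *)
Lemma finite_union_bound (T : eqType) (s : seq T) (A : T -> set Omega) (b : R) :
  (forall i, i \in s -> measurable (A i) /\ (P (A i) <= b%:E)%E) ->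
  exists Bad, [/\ measurable Bad, (P Bad <= ((size s)%:R * b)%:E)%E &
    forall i, i \in s -> A i `<=` Bad].
Proof.
elim: s => [_|i s ih sA].
  by exists set0; rewrite measure0 mul0r.
have [|Bad [mB PB sB]] := ih; first by move=> j js; apply: sA; rewrite inE js orbT.
have [mAi PAi] := sA i (mem_head _ _).
exists (A i `|` Bad); split; first exact: measurableU.
  rewrite (le_trans (measureU2 _ _ _))//= -[(size s).+1]add1n natrD mulrDl mul1r EFinD.
  exact: leeD.
by move=> j; rewrite inE => /predU1P[->|js]; [exact: subsetUl|apply: subset_trans (sB j js) _; exact: subsetUr].
Qed.

Lemma ip_gram_shift r p (W : 'M[R]_(r, p)) (c : R) (v : 'cV[R]_r) :
  ip v ((W *m W^T - c%:M) *m v) = sqn (W^T *m v) - c * sqn v.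
Proof.
rewrite mulmxBl mul_scalar_mx ipDr -scaleN1r !ipZr mulN1r -mulmxA.
by rewrite ipC ip_mull.
Qed.

Lemma gram_shift_sym r p (W : 'M[R]_(r, p)) (c : R) :
  (W *m W^T - c%:M)^T = W *m W^T - c%:M.
Proof. by rewrite linearB /= trmx_mul trmxK tr_scalar_mx. Qed.

Lemma gram_shift_diag r p (W : 'M[R]_(r, p)) (c : R) i :
  (W *m W^T - c%:M) i i = sqn (W^T *m (delta_mx i 0 : 'cV_r)) - c.
Proof.
rewrite !mxE eqxx mulr1n; congr (_ - _); rewrite -colE sqnE.
by apply: eq_bigr => j _; rewrite big_ord1 !mxE expr2.
Qed.

Lemma unit_scaling r (x : 'cV[R]_r) : (0 < r)%N -> x != 0 ->
  exists2 c : R, 0 < c & sqn (c *: x) = (4 * r)%:R.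
Proof.
move=> r0 x0; have x1 : 0 < sqn x by rewrite sqn_gt0.
have h : 0 < (4 * r)%:R / sqn x by rewrite divr_gt0// ltr0n muln_gt0.
exists (Num.sqrt ((4 * r)%:R / sqn x)); first by rewrite sqrtr_gt0.
by rewrite sqnZ sqr_sqrtr ?ltW// divfK// gt_eqF.
Qed.

(** Outside [Bad], the lower tail bound holds at all nonzero net points and the upper one at the
    unit vectors, which bounds the diagonal of [W W^T - a]. A vector violating the claim would then
    round to a net point violating the lower tail bound. *)
Lemma sketch_lob_ge2 (r n p : nat) (G : 'I_r -> 'I_n -> {RV P >-> R}) (K : 'M[R]_(n, p)) :
  gaussian_mx G -> orthonormal_cols K -> (1 < r)%N -> (21 * (r - 1) <= p)%N ->
  exists Bad, [/\ measurable Bad, (P Bad <= (expR (- (p%:R / 20)))%:E)%E &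
    forall w, ~ Bad w -> lob (sketch_rv G K w) (3 / 50 * (r + p)%:R)].
Proof.
move=> hG Ko r1 rp.
pose A f := [set w | (sqn ((sketch_rv G K w)^T *m net_point R f) <=
  18 / 100 * p%:R * sqn (net_point R f))%R].
have [|B1 [mB1 PB1 hB1]] := @finite_union_bound _
    [seq f <- enum (net r) | net_point R f != 0] A (expR (27 / 100 * p%:R) / 2 ^+ p).
  move=> f; rewrite mem_filter => /andP[f0 _].
  split; first exact: measurable_sqn_sketch_le.
  exact: sketch_lower_tail.
pose e i : 'cV[R]_r := delta_mx i 0.
have [|B2 [mB2 PB2 hB2]] := @finite_union_bound _ (enum 'I_r)
    (fun i => [set w | (2 * p%:R * sqn (e i) <= sqn ((sketch_rv G K w)^T *m e i))%R])
    (expR (- (p%:R / 2)) * Num.sqrt (2 ^+ p)).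
  move=> i _; split; first exact: measurable_sqn_sketch_ge.
  by apply: sketch_upper_tail => //; rewrite -sqn_eq0 sqn_delta oner_eq0.
exists (B1 `|` B2); split; first exact: measurableU.
  rewrite (le_trans (measureU2 _ _ _))// (le_trans (leeD PB1 PB2))// -EFinD lee_fin.
  rewrite -cardE card_ord.
  have p21 : 21 * (r%:R - 1) <= p%:R :> R.
    have := rp; rewrite -(ler_nat R) natrM natrB//; exact: ltnW.
  have r2 : 2 <= r%:R :> R by rewrite ler_nat.
  have c1 : (size [seq f <- enum (net r) | net_point R f != 0])%:R <= expR (3 * r%:R) :> R.
    apply: le_trans (pow17_upper r); apply: le_trans (card_net R r).
    by rewrite ler_nat size_filter (leq_trans (count_size _ _))// -cardE.
  have c2 : r%:R <= expR (3 / 4 * (r%:R - 1)) :> R.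
    have -> : r%:R - 1 = (r.-1)%:R :> R by rewrite -subn1 natrB// ltnW.
    apply: le_trans (pow2_upper _); rewrite -natrX ler_nat.
    by rewrite -[X in (X <= _)%N](prednK (ltnW r1)) ltn_expl.
  have t1 : (size [seq f <- enum (net r) | net_point R f != 0])%:R *
      (expR (27 / 100 * p%:R) / 2 ^+ p) <= expR (- (p%:R * (4 / 45))) :> R.
    apply: (@le_trans _ _ (expR (3 * r%:R) * expR (- (38 / 100 * p%:R)))).
      by rewrite ler_pM ?lower_tail_le// divr_ge0 ?expR_ge0 ?exprn_ge0.
    by rewrite -expRD ler_expR; lra.
  have t2 : r%:R * (expR (- (p%:R / 2)) * Num.sqrt (2 ^+ p)) <=
      expR (- (p%:R * (4 / 45))) :> R.
    apply: (@le_trans _ _ (expR (3 / 4 * (r%:R - 1)) * expR (- (p%:R / 8)))).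
      by rewrite ler_pM ?upper_tail_le// mulr_ge0 ?expR_ge0 ?sqrtr_ge0.
    by rewrite -expRD ler_expR; lra.
  (* The factor 2 is absorbed by [exp (3 / 4)], since [p >= 21] gives
     [3 / 4 <= p (4 / 45 - 1 / 20)]. *)
  apply: (@le_trans _ _ (2 * expR (- (p%:R * (4 / 45))))).
    by apply: (le_trans (lerD t1 t2)); lra.
  apply: (@le_trans _ _ (expR (3 / 4) * expR (- (p%:R * (4 / 45))))).
    by rewrite ler_wpM2r ?expR_ge0// (le_trans _ expR_3_4_ge)//; lra.
  by rewrite -expRD ler_expR; lra.
move=> w nB x; have [->|x0] := eqVneq x 0; first by rewrite mulmx0 !sqn0 mulr0.
set W := sketch_rv G K w; rewrite leNgt; apply/negP => bad.
have [c c0 cx] := unit_scaling (ltnW r1) x0.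
set a := 18 / 100 * p%:R : R.
have p0 : 0 <= p%:R :> R by [].
have p21 : 21 * (r%:R - 1) <= p%:R :> R.
  have := rp; rewrite -(ler_nat R) natrM natrB//; exact: ltnW.
have r2 : 2 <= r%:R :> R by rewrite ler_nat.
have diag i : (W *m W^T - a%:M) i i <= 91 / 50 * p%:R.
  rewrite gram_shift_diag /a.
  have : sqn (W^T *m e i) <= 2 * p%:R.
    rewrite leNgt; apply/negP => /ltW h; apply: nB; right.
    by apply: (hB2 i); rewrite ?mem_enum//= /e sqn_delta mulr1.
  rewrite /e; lra.
have T0 : 0 <= 91 / 50 * p%:R :> R by lra.
have [f fnet] := net_quadratic (gram_shift_sym W a) T0 diag cx.
rewrite !ip_gram_shift cx -scalemxAr sqnZ => hf.
have {}hf : sqn (W^T *m net_point R f) < a * sqn (net_point R f).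
  (* Divided by [4 r], the bound on the form is [3 / 50 (r + p) - 18 / 100 p + 91 / 800 p],
     nonpositive once [p >= 9.6 r]; [r >= 2] gives [p >= 21 (r - 1) >= 10.5 r]. *)
  rewrite -subr_lt0; apply: le_lt_trans hf _.
  have bad' : c ^+ 2 * sqn (W^T *m x) < 3 / 50 * (r + p)%:R * (4 * r)%:R.
    have c2 : 0 < c ^+ 2 by rewrite exprn_gt0.
    by rewrite -cx sqnZ mulrCA ltr_pM2l.
  have rp0 : 0 < r%:R * p%:R :> R by apply: mulr_gt0; lra.
  move: bad'; rewrite /a natrD natrM; nra.
apply: nB; left; apply: (hB1 f); last by rewrite /A /= ltW.
rewrite mem_filter mem_enum fnet andbT; apply/eqP => f0.
by move: hf; rewrite f0 mulmx0 !sqn0 mulr0 ltxx.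
Qed.

(** For [r = 1] the number [p] may be too small for the net argument, but there is only one
    direction and the tail bound at a single vector suffices. *)
Lemma sketch_lob_1 (n p : nat) (G : 'I_1 -> 'I_n -> {RV P >-> R}) (K : 'M[R]_(n, p)) :
  gaussian_mx G -> orthonormal_cols K -> (0 < p)%N ->
  exists Bad, [/\ measurable Bad, (P Bad <= (expR (- (p%:R / 20)))%:E)%E &
    forall w, ~ Bad w -> lob (sketch_rv G K w) (3 / 50 * (1 + p)%:R)].
Proof.
move=> hG Ko p0; set e : 'cV[R]_1 := delta_mx 0 0.
have e1 : sqn e = 1 by exact: sqn_delta.
exists [set w | (sqn ((sketch_rv G K w)^T *m e) <= 18 / 100 * p%:R * sqn e)%R]; split.
- exact: measurable_sqn_sketch_le.
- apply: (le_trans (sketch_lower_tail hG Ko _)); first by rewrite -sqn_eq0 e1 oner_eq0.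
  rewrite lee_fin (le_trans (lower_tail_le p))// ler_expR.
  have : 0 <= p%:R :> R by []; lra.
- move=> w /= /negP; rewrite -ltNge e1 mulr1 => h x.
  have -> : x = x 0 0 *: e.
    by apply/matrixP => i j; rewrite !mxE !ord1 eqxx mulr1.
  rewrite -scalemxAr !sqnZ e1 mulr1 [leLHS]mulrC ler_wpM2l ?sqr_ge0//.
  have p1 : 1 <= p%:R :> R by rewrite ler1n.
  by rewrite natrD; lra.
Qed.

Lemma sketch_lob (r n p : nat) (G : 'I_r -> 'I_n -> {RV P >-> R}) (K : 'M[R]_(n, p)) :
  gaussian_mx G -> orthonormal_cols K -> (0 < r)%N -> (0 < p)%N ->
  (21 * (r - 1) <= p)%N ->
  exists Bad, [/\ measurable Bad, (P Bad <= (expR (- (p%:R / 20)))%:E)%E &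
    forall w, ~ Bad w -> lob (sketch_rv G K w) (3 / 50 * (r + p)%:R)].
Proof.
case: r G => [//|[|r]] G hG Ko _ p0 rp; first exact: sketch_lob_1.
exact: sketch_lob_ge2.
Qed.

(** Rounding is applied to the negated form [2 n - W W^T], with diagonal at most [2 n]; its cost of
    [2 n / 16] per unit explains [17 / 8 = 2 + 1 / 8]. *)
Lemma gaussian_opb (r n : nat) (G : 'I_r -> 'I_n -> {RV P >-> R}) :
  gaussian_mx G -> (0 < r)%N -> (36 * r < n)%N ->
  exists Bad, [/\ measurable Bad, (P Bad <= (expR (- (n%:R / 72)))%:E)%E &
    forall w, ~ Bad w -> opb (random_mx G w)^T (17 / 8 * n%:R)].
Proof.
move=> hG r0 rn.
have Ko : orthonormal_cols (1%:M : 'M[R]_n) by rewrite /orthonormal_cols trmx1 mul1mx.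
pose A f := [set w | (2 * n%:R * sqn (net_point R f) <=
  sqn ((sketch_rv G 1%:M w)^T *m net_point R f))%R].
have [|Bad [mB PB hB]] := @finite_union_bound _
    [seq f <- enum (net r) | net_point R f != 0] A
    (expR (- (n%:R / 2)) * Num.sqrt (2 ^+ n)).
  move=> f; rewrite mem_filter => /andP[f0 _].
  split; first exact: measurable_sqn_sketch_ge.
  exact: sketch_upper_tail.
have rn' : 36 * r%:R <= n%:R :> R by rewrite -natrM ler_nat ltnW.
have r1 : 1 <= r%:R :> R by rewrite ler1n.
exists Bad; split=> //.
  apply: le_trans PB _; rewrite lee_fin.
  apply: (@le_trans _ _ (expR (3 * r%:R) * expR (- (n%:R / 8)))).
    rewrite ler_pM ?upper_tail_le// ?mulr_ge0 ?expR_ge0 ?sqrtr_ge0//.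
    apply: le_trans (pow17_upper r); apply: le_trans (card_net R r).
    by rewrite ler_nat size_filter (leq_trans (count_size _ _))// -cardE.
  by rewrite -expRD ler_expR; lra.
move=> w nB x; have [->|x0] := eqVneq x 0; first by rewrite mulmx0 !sqn0 mulr0.
set W := random_mx G w; rewrite leNgt; apply/negP => bad.
have WE : sketch_rv G 1%:M w = W by rewrite /sketch_rv mulmx1.
have [c c0 cx] := unit_scaling r0 x0.
have n0 : 0 < n%:R :> R by lra.
set F := W *m W^T - (2 * n%:R)%:M.
have Fs : (- F)^T = - F by rewrite linearN /= gram_shift_sym.
have diag i : (- F) i i <= 2 * n%:R.
  by rewrite mxE gram_shift_diag opprB gerBl sqn_ge0.
have [f fnet] := net_quadratic Fs (mulr_ge0 (ler0n _ 2) (ltW n0)) diag cx.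
have FE (v : 'cV[R]_r) : ip v (- F *m v) = 2 * n%:R * sqn v - sqn (W^T *m v).
  have -> : - F *m v = (-1) *: (F *m v) by rewrite mulNmx scaleN1r.
  by rewrite ipZr /F (ip_gram_shift W (2 * n%:R) v) mulN1r opprB.
rewrite !FE cx -scalemxAr sqnZ => hf.
have {}hf : 2 * n%:R * sqn (net_point R f) < sqn (W^T *m net_point R f).
  rewrite -subr_lt0; apply: le_lt_trans hf _.
  have bad' : 17 / 8 * n%:R * (4 * r)%:R < c ^+ 2 * sqn (W^T *m x).
    have c2 : 0 < c ^+ 2 by rewrite exprn_gt0.
    by rewrite -cx sqnZ mulrCA ltr_pM2l.
  by move: bad'; rewrite natrM; nra.
apply: nB; apply: (hB f); last by rewrite /A /= WE ltW.
rewrite mem_filter mem_enum fnet andbT; apply/eqP => f0.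
by move: hf; rewrite f0 mulmx0 !sqn0 mulr0 ltxx.
Qed.

End ExtremeSingularValues.

(** * Removing the shift and orthonormalizing the sketch matrix *)

Section ShiftedGaussian.
Variable R : realType.

(** The last [p] right singular vectors of [D] lie in its kernel. *)
Lemma orthonormal_complement r p (D : 'M[R]_(r, r + p)) :
  exists2 V : 'M[R]_(r + p, p), orthonormal_cols V & D *m V = 0.
Proof.
have [_ Vo _ _ DE] := svdP D; set V := (svd D).2 in Vo DE.
have VV : V^T *m rsubmx V = col_mx 0 1%:M.
  by rewrite mulmx_rsub Vo scalar_mx_block block_mxEh row_mxKr.
exists (rsubmx V).
  rewrite /orthonormal_cols.
  have -> : (rsubmx V)^T = dsubmx V^T by rewrite trmx_rsub.
  by rewrite mul_dsub_mx VV col_mxKd.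
rewrite [D in D *m _]DE -mulmxA VV -mulmxA.
apply/matrixP => i j; rewrite [RHS]mxE mxE big1// => k _; rewrite mxE big1 ?mulr0// => h _.
rewrite mxE; case: eqP => [kh|]; last by rewrite mul0r.
have hr : (h < r)%N by rewrite -kh.
have -> : h = lshift p (Ordinal hr) by apply: val_inj.
by rewrite col_mxEu mxE mulr0.
Qed.

(** Taken from the singular value decomposition: [Q] consists of the first [l] left singular
    vectors, and the rank of [H] makes the remaining square factor invertible. *)
Lemma thin_qr n l (H : 'M[R]_(n, l)) : \rank H = l ->
  exists Q (S : 'M[R]_l), [/\ orthonormal_cols Q, S \in unitmx & H = Q *m S].
Proof.
move=> Hl; have ln : (l <= n)%N by rewrite -Hl rank_leq_row.
have [Uo _ _ _ HE] := svdP H; set U := (svd H).1.1 in Uo HE.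
set s := (svd H).1.2 in HE; set V := (svd H).2 in HE.
pose J : 'M[R]_(n, l) := rect_diag n l (fun=> 1).
have Jo : orthonormal_cols J.
  apply/matrixP => i j; rewrite !mxE.
  have ni : (i < n)%N by rewrite (leq_trans (ltn_ord i)).
  rewrite (bigD1 (Ordinal ni))//= !mxE /= eqxx mul1r big1 ?addr0 => [|k ki].
    by rewrite -val_eqE; case: eqP.
  rewrite !mxE; case: eqP => [ki'|]; last by rewrite mul0r.
  by move/eqP: ki; case; apply: val_inj.
have JE : rect_diag n l s = J *m rect_diag l l s.
  apply/matrixP => i j; rewrite !mxE (bigD1 j)//= !mxE eqxx big1 ?addr0 => [|k kj].
    by case: eqP => [->|]; rewrite ?mul1r ?mul0r.
  rewrite !mxE; case: (eqVneq (k : nat) j) => [kj'|]; last by rewrite mulr0.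
  by move/eqP: kj; case; apply: val_inj.
have HQ : H = U *m J *m (rect_diag l l s *m V^T) by rewrite {1}HE JE !mulmxA.
exists (U *m J), (rect_diag l l s *m V^T); split=> //.
  by rewrite /orthonormal_cols trmx_mul -mulmxA (mulmxA U^T) Uo mul1mx.
rewrite -row_full_unit /row_full eqn_leq rank_leq_row /= -{1}Hl {1}HQ.
exact: mxrankM_maxr.
Qed.

(** The matrix [X] is literally the same, as [(T S^-1)^-1 = S T^-1]. *)
Lemma sketch_err_mulr N m n l (M : 'M[R]_(m, n)) (Q : 'M[R]_(n, l)) (S T : 'M[R]_l) :
  S \in unitmx -> T \in unitmx ->
  sketch_err N M (Q *m S) T = sketch_err N M Q (T *m invmx S).
Proof.
move=> Su Tu.
have inv : invmx (T *m invmx S) = S *m invmx T.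
  have TSu : T *m invmx S \in unitmx by rewrite unitmx_mul Tu unitmx_inv.
  apply: (can_inj (mulKmx TSu)); rewrite mulmxV//.
  by rewrite -mulmxA (mulmxA (invmx S)) mulVmx// mul1mx mulmxV.
by rewrite /sketch_err /sketch_X inv !mulmxA.
Qed.

Variables (d : measure_display) (Omega : measurableType d) (P : probability Omega R).

(* Projecting onto the orthogonal complement of the row space of D K, of
   dimension at least l - r, removes the shift D. *)
Lemma shifted_lob (r n l : nat) (G : 'I_r -> 'I_n -> {RV P >-> R})
    (D : 'M[R]_(r, n)) (K : 'M[R]_(n, l)) :
  gaussian_mx G -> orthonormal_cols K -> (0 < r < l)%N -> (22 * (r - 1) < l)%N ->
  exists Bad, [/\ measurable Bad, (P Bad <= (expR (- ((l%:R - r%:R) / 20)))%:E)%E &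
    forall w, ~ Bad w -> lob ((random_mx G w + D) *m K) (3 / 50 * l%:R)].
Proof.
move=> hG Ko /andP[r0 rl] rl22.
have [p lE] : exists p, l = (r + p)%N by exists (l - r)%N; lia.
subst l; have p0 : (0 < p)%N by lia.
have rp : (21 * (r - 1) <= p)%N by lia.
have [V Vo DV] := orthonormal_complement (D *m K).
have KVo : orthonormal_cols (K *m V).
  by rewrite /orthonormal_cols trmx_mul -mulmxA (mulmxA K^T) Ko mul1mx.
have [Bad [mB PB hB]] := sketch_lob hG KVo r0 p0 rp.
exists Bad; split=> //; first by rewrite natrD addrC addKr.
move=> w nB x; apply: le_trans (hB w nB x) _.
have -> : sketch_rv G (K *m V) w = (random_mx G w + D) *m K *m V.
  by rewrite /sketch_rv [in RHS]mulmxDl [in RHS]mulmxDl DV addr0 mulmxA.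
rewrite trmx_mul -mulmxA -[leRHS]mul1r.
by apply: opb_tr => // y; rewrite mul1r (sqn_orthonormal _ Vo).
Qed.

End ShiftedGaussian.

(** * Combining the deterministic bound with the probabilistic estimates *)

Section MainBound.
Variables (R : realType) (d : measure_display) (Omega : measurableType d).
Variables (P : probability Omega R) (m n r l : nat).
Hypotheses (r0 : (0 < r)%N) (rl : (r <= l)%N) (lmn : (l < minn m n)%N).
Hypotheses (hnr : (36 * r < n)%N) (hlr : (22 * (r - 1) < l)%N).
Variable G : 'I_r -> 'I_n -> {RV P >-> R}.
Hypothesis hG : gaussian_mx G.
Variables (A : 'M[R]_(m, r)) (E : 'M[R]_(m, n)) (N : norm_kind).
Hypothesis hA : \rank A = r.
Hypothesis hE : frob_norm E <= sing_val A r / 12.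

Let M w := A *m ((Num.sqrt n%:R)^-1 *: random_mx G w) + E.
Let nl : R := n%:R / l%:R.
Let prob : R := 1 - expR (- ((l%:R - r%:R) / 20))
                  - expR (- ((n%:R - r%:R) / 20)) - expR (- (n%:R / 72)).

Lemma measurable_err_ratio (H : 'M[R]_(n, l)) (T : 'M[R]_l) (c : R) :
  T \in unitmx -> 0 <= c ->
  measurable [set w | sketch_err N (M w) H T / tail_sv N r (M w) <= c].
Proof.
move=> Tu c0.
have mM i j : measurable_fun setT (fun w => M w i j).
  under eq_fun do rewrite mxE [X in X + _]mxE.
  apply: measurable_funD => //; apply: measurable_sum => k.
  apply: measurable_funM => //; under eq_fun do rewrite mxE.
  by apply: measurable_funM => //; exact: measurable_random_mx.
have merr := measurable_fun_usc mM (fun c => @sketch_err_usc R N m n l H T c Tu).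
have rmn : (r < minn m n)%N by exact: leq_ltn_trans lmn.
have mtail := measurable_fun_usc mM (fun c => @tail_sv_usc R N m n r c rmn).
(* Division by zero yields 0, which is at most [c], so the outcomes with vanishing tail belong to
   the event. *)
have -> : [set w | sketch_err N (M w) H T / tail_sv N r (M w) <= c] =
    [set w | sketch_err N (M w) H T <= c * tail_sv N r (M w)] `|`
    [set w | tail_sv N r (M w) <= 0].
  apply/seteqP; split => w /=; have t0 := tail_sv_ge0 N r (M w).
    have [->|tn0] := eqVneq (tail_sv N r (M w)) 0; first by right.
    by rewrite ler_pdivrMr ?lt_def ?tn0//; left.
  case=> h; last first.
    by rewrite (_ : tail_sv _ _ _ = 0) ?invr0 ?mulr0//; apply/eqP; rewrite eq_le h t0.
  have [->|tn0] := eqVneq (tail_sv N r (M w)) 0; first by rewrite invr0 mulr0.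
  by rewrite ler_pdivrMr ?lt_def ?tn0.
apply: measurableU; rewrite -[X in measurable X]setTI; apply: measurable_fun_le => //.
exact: measurable_funM.
Qed.

Let Ap := (rinv A^T)^T.
Let F := E - A *m (Ap *m E).
(** The scaling makes [sqrt n] times [C] a standard Gaussian matrix plus a constant. *)
Let D := Num.sqrt n%:R *: (Ap *m E).
Let C w := (Num.sqrt n%:R)^-1 *: (random_mx G w + D).

Let rm : (0 < r <= m)%N.
Proof. by rewrite r0 /=; move: lmn; rewrite leq_min => /andP[lm _]; lia. Qed.

Let sg := sing_val A r.
Let sg0 : 0 < sg. Proof. exact: sing_val_gt0. Qed.
Let Asg : lob A^T (sg ^+ 2). Proof. exact: lob_sing_val. Qed.
Let Af : row_free A^T. Proof. by rewrite /row_free mxrank_tr hA. Qed.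
Let n0 : 0 < n%:R :> R. Proof. by rewrite ltr0n; lia. Qed.
Let l0 : 0 < l%:R :> R. Proof. by rewrite ltr0n; lia. Qed.

Let AAp : A *m Ap = rowproj A^T.
Proof. by rewrite /Ap -[RHS]rowproj_sym /rowproj [RHS]trmx_mul trmxK. Qed.

Let ME w : M w = A *m C w + F.
Proof.
rewrite /M /C /D /F scalerDr scalerA mulVf ?scale1r; last by rewrite gt_eqF// sqrtr_gt0.
by rewrite mulmxDr -addrA [X in _ = _ + X]addrC subrK.
Qed.

Let AF : A^T *m F = 0.
Proof.
rewrite /F mulmxBr (mulmxA A Ap) AAp mulmxA mul_rowproj// subrr.
by [].
Qed.

Let opbE : opb E ((sg / 12) ^+ 2).
Proof.
move=> x; apply: le_trans (opb_frob E x) _; rewrite ler_wpM2r ?sqn_ge0//.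
by rewrite -frob_norm_le// divr_ge0// ltW.
Qed.

Let opbF : opb F ((sg / 12) ^+ 2).
Proof.
have -> : F = (1%:M - rowproj A^T) *m E by rewrite mulmxBl mul1mx -AAp -mulmxA.
rewrite -[_ ^+ 2]mul1r; apply: opb_mul => //.
by apply: opb_coproj; [exact: rowproj_sym|exact: rowproj_idem].
Qed.

Let opbApE : opb (Ap *m E) (12^-1 ^+ 2).
Proof.
have -> : 12^-1 ^+ 2 = (sg ^+ 2)^-1 * (sg / 12) ^+ 2 by field; rewrite gt_eqF.
apply: opb_mul => //; first by rewrite invr_ge0 sqr_ge0.
apply: opb_tr; first by rewrite invr_ge0 sqr_ge0.
by apply: opb_rinv; rewrite ?exprn_gt0.
Qed.

Let opbC w : opb (random_mx G w)^T (17 / 8 * n%:R) -> opb (C w)^T ((31 / 20) ^+ 2).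
Proof.
move=> hw x.
have fx : 0 <= frob_norm x by exact: frob_norm_ge0.
rewrite -(sqr_frob_norm x) -exprMn -frob_norm_le; last by rewrite mulr_ge0// divr_ge0.
have CE : (C w)^T *m x = (Num.sqrt n%:R)^-1 *: ((random_mx G w)^T *m x) + (Ap *m E)^T *m x.
  rewrite /C linearZ /= linearD /= -scalemxAl mulmxDl scalerDr; congr (_ + _).
  rewrite /D linearZ /= -scalemxAl scalerA mulVf ?scale1r//.
  by rewrite gt_eqF// sqrtr_gt0.
rewrite CE (le_trans (frob_normD _ _))//.
(* Here [(73 / 50)^2 >= 17 / 8], and [73 / 50 + 1 / 12 <= 31 / 20]. *)
have h1 : frob_norm ((Num.sqrt n%:R)^-1 *: ((random_mx G w)^T *m x)) <= 73 / 50 * frob_norm x.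
  rewrite frob_norm_le ?mulr_ge0// sqnZ exprVn sqr_sqrtr ?(ltW n0)//.
  rewrite ler_pdivrMl// (le_trans (hw x))// exprMn sqr_frob_norm mulrA ler_wpM2r ?sqn_ge0//.
  by have := n0; rewrite !expr2; lra.
have h2 : frob_norm ((Ap *m E)^T *m x) <= 12^-1 * frob_norm x.
  rewrite frob_norm_le ?mulr_ge0// exprMn sqr_frob_norm.
  by apply: opb_tr => //; exact: sqr_ge0.
by lra.
Qed.

Let lobC q (K : 'M[R]_(n, q)) w (b : R) : lob ((random_mx G w + D) *m K) (b * n%:R) ->
  lob (C w *m K) b.
Proof.
move=> h x; rewrite /C -scalemxAl linearZ /= -scalemxAl sqnZ exprVn sqr_sqrtr ?(ltW n0)//.
by rewrite ler_pdivlMl// mulrA mulrC [n%:R * b]mulrC mulrC.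
Qed.

Let ratio_le (H : 'M[R]_(n, l)) (T : 'M[R]_l) w :
  orthonormal_cols H -> T \in unitmx ->
  lob ((random_mx G w + D) *m H) (3 / 50 * l%:R) ->
  lob ((random_mx G w + D) *m 1%:M) (3 / 50 * n%:R) ->
  opb (random_mx G w)^T (17 / 8 * n%:R) ->
  sketch_err N (M w) H T / tail_sv N r (M w) <= Num.sqrt (1 + 100 * nl).
Proof.
move=> Ho Tu h1 h2 h3.
have t0 := tail_sv_ge0 N r (M w).
have [->|tn0] := eqVneq (tail_sv N r (M w)) 0; first by rewrite invr0 mulr0 sqrtr_ge0.
rewrite ler_pdivrMr ?lt_def ?tn0//.
pose al : R := Num.sqrt (3 / 50 * (l%:R / n%:R)).
have al2 : al ^+ 2 = 3 / 50 * (l%:R / n%:R).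
  by rewrite sqr_sqrtr// mulr_ge0// divr_ge0// ltW.
have al0 : 0 < al by rewrite sqrtr_gt0 mulr_gt0// divr_gt0.
have CH : lob (C w *m H) (al ^+ 2).
  apply: lobC; rewrite al2.
  by rewrite (_ : 3 / 50 * (l%:R / n%:R) * n%:R = 3 / 50 * l%:R)//; field; rewrite gt_eqF.
(* The value [6 / 25] has square [0.0576], just below [3 / 50]. *)
have CG : lob (C w) ((6 / 25) ^+ 2).
  move=> x; have := @lobC _ 1%:M w (3 / 50) h2 x; rewrite mulmx1; apply: le_trans.
  by rewrite ler_wpM2r ?sqn_ge0//; lra.
have eps0 : 0 <= sg / 12 by rewrite divr_ge0// ltW.
have ga0 : 0 < 6 / 25 :> R by lra.
have epsga : sg / 12 <= sg * (6 / 25) by rewrite ler_wpM2l ?ltW//; lra.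
have := @sketch_err_le_tail R N m n r l A (C w) F H T (trunc_mx r (M w))
  sg (sg / 12) al (31 / 20) (6 / 25) sg0 eps0 al0 ga0 epsga Tu Ho Asg AF opbF CG
  (opbC h3) CH (rank_trunc_mx _ _).
rewrite -ME -/(tail_sv N r (M w)) => h; apply: le_trans h _.
rewrite ler_wpM2r// al2.
have -> : sg / 12 / (sg * (6 / 25)) = 25 / 72 by field; rewrite gt_eqF.
have nl1 : 1 <= nl.
  rewrite /nl ler_pdivlMr// mul1r ler_nat; move: lmn; rewrite leq_min => /andP[_ ln].
  exact: ltnW.
have -> : (31 / 20) ^+ 2 / (3 / 50 * (l%:R / n%:R)) = 961 / 24 * nl.
  by rewrite /nl; field; rewrite !gt_eqF.
(* It remains to see that [(97 / 72)^2 (1 + 961 / 24 nl) <= 1 + 100 nl]; the left side is below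
   [1.82 + 72.7 nl], and [nl >= 1]. *)
have -> : 1 + 25 / 72 = Num.sqrt ((97 / 72) ^+ 2) :> R.
  by rewrite sqrtr_sqr ger0_norm; lra.
rewrite -sqrtrM; last by lra.
by rewrite ler_sqrt; lra.
Qed.

Lemma ratio_probability (H : 'M[R]_(n, l)) (T : 'M[R]_l) (c : R) :
  orthonormal_cols H -> T \in unitmx -> Num.sqrt (1 + 100 * nl) <= c ->
  (prob%:E <= P [set w | (sketch_err N (M w) H T / tail_sv N r (M w) <= c)%R])%E.
Proof.
move=> Ho Tu hc.
have c0 : 0 <= c by apply: le_trans hc; exact: sqrtr_ge0.
have [rl'|lr] := ltnP r l; last first.
  (* For [l = r] the first exponential is 1, so the claimed lower bound is at most 0. *)
  apply: (@le_trans _ _ 0%E) => //; rewrite lee_fin /prob.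
  have -> : l%:R - r%:R = 0 :> R by apply/eqP; rewrite subr_eq0 eqr_nat; lia.
  rewrite mul0r oppr0 expR0 subrr sub0r -opprD oppr_le0.
  by rewrite addr_ge0 ?expR_ge0.
have Io : orthonormal_cols (1%:M : 'M[R]_n) by rewrite /orthonormal_cols trmx1 mul1mx.
have rl2 : (0 < r < l)%N by rewrite r0.
have rn2 : (0 < r < n)%N by lia.
have rn22 : (22 * (r - 1) < n)%N by lia.
(* The three bad events concern the smallest singular value of [C H], that of [C] (taking the
   identity for [K]), and the largest one of [G]. *)
have [B1 [mB1 PB1 hB1]] := shifted_lob D hG Ho rl2 hlr.
have [B2 [mB2 PB2 hB2]] := shifted_lob D hG Io rn2 rn22.
have [B3 [mB3 PB3 hB3]] := gaussian_opb hG r0 hnr.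
have mB : measurable (B1 `|` B2 `|` B3) by apply: measurableU => //; exact: measurableU.
have PB : (P (B1 `|` B2 `|` B3) <= (expR (- ((l%:R - r%:R) / 20))
    + expR (- ((n%:R - r%:R) / 20)) + expR (- (n%:R / 72)))%:E)%E.
  rewrite (le_trans (measureU2 _ _ _))//; first exact: measurableU.
  rewrite 2!EFinD leeD// (le_trans (measureU2 _ _ _))//.
  exact: leeD.
apply: (@le_trans _ _ (P (~` (B1 `|` B2 `|` B3)))).
  rewrite probability_setC// /prob.
  rewrite (_ : 1 - _ - _ - _ = 1 - (expR (- ((l%:R - r%:R) / 20))
    + expR (- ((n%:R - r%:R) / 20)) + expR (- (n%:R / 72)))); last by ring.
  by rewrite EFinB leeB.
apply: le_measure; rewrite ?inE//.
- exact: measurableC.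
- exact: measurable_err_ratio.
move=> w /= /not_orP[/not_orP[n1 n2] n3]; apply: le_trans hc.
by apply: ratio_le => //; [exact: hB1|exact: hB2|exact: hB3].
Qed.

End MainBound.

Theorem theorem5p2 (R : realType) (d : measure_display)
    (Omega : measurableType d) (P : probability Omega R)
    (m n r l : nat)
    (hm : (0 < m)%N) (hn : (0 < n)%N) (hr : (0 < r)%N) (hl : (0 < l)%N)
    (hrl : (r <= l)%N) (hlmn : (l < minn m n)%N)
    (hnr : (36 * r < n)%N) (hlr : (22 * (r - 1) < l)%N)
    (G : 'I_r -> 'I_n -> {RV P >-> R}) (hG : gaussian_mx G)
    (H : 'M[R]_(n, l)) (A : 'M[R]_(m, r)) (E : 'M[R]_(m, n))
    (hA : \rank A = r)
    (T : 'M[R]_l) (hT : T \in unitmx)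
    (N : norm_kind) :
  let B w := (Num.sqrt n%:R)^-1 *: random_mx G w in
  let M w := A *m B w + E in
  let nl : R := n%:R / l%:R in
  let prob : R := 1 - expR (- ((l%:R - r%:R) / 20))
                    - expR (- ((n%:R - r%:R) / 20)) - expR (- (n%:R / 72)) in
  (* the ratios below are well defined, up to an event of probability 0 *)
  {ae P, forall w, 0 < tail_sv N r (M w)} ->
  (orthonormal_cols H ->
   frob_norm E <= sing_val A r / (48 * Num.sqrt nl + 6) ->
   (prob%:E <= P [set w | (sketch_err N (M w) H T / tail_sv N r (M w)
                           <= Num.sqrt (1 + 100 * nl))%R])%E)
  /\
  (\rank H = l ->
   frob_norm E <= sing_val A r / 12 *
     Num.min 1 (1 / (4 * Num.sqrt nl * sing_val H l + 1 / 2)) ->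
   (prob%:E <= P [set w | (sketch_err N (M w) H T / tail_sv N r (M w)
                           <= Num.sqrt (1 + 100 * cond_num H ^+ 2 * nl))%R])%E).
Proof.
move=> B M nl prob _.
have nl1 : 1 <= nl.
  rewrite /nl ler_pdivlMr ?ltr0n// mul1r ler_nat.
  by move: hlmn; rewrite leq_min => /andP[_ /ltnW].
have nl0 : 0 <= nl by exact: le_trans ler01 nl1.
have sg0 := sing_val_ge0 A r.
split=> [Ho hE|Hl hE].
  apply: ratio_probability => //.
  apply: le_trans hE _; rewrite ler_wpM2l// lef_pV2 ?posrE; last 2 first.
  - by rewrite ltr_wpDl// mulr_ge0// sqrtr_ge0.
  - by [].
  (* Since [nl >= 1], the denominator [48 sqrt nl + 6] is at least 12. *)
  have : 1 <= Num.sqrt nl by rewrite -[X in X <= _]sqrtr1 ler_sqrt//.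
  by lra.
have hE' : frob_norm E <= sing_val A r / 12.
  apply: le_trans hE _; rewrite ler_piMr ?divr_ge0//.
  by rewrite ge_min lexx.
have [Q [S [Qo Su HQ]]] := thin_qr Hl.
have k1 := cond_num_ge1 hl Hl.
(* The matrix [H = Q S] is traded for [Q], with [T S^-1] in place of [T]; the factor
   [cond_num H ^+ 2 >= 1] only weakens the resulting bound. *)
under eq_set do rewrite [in sketch_err _ _ H _]HQ sketch_err_mulr//.
apply: ratio_probability => //; first by rewrite unitmx_mul hT unitmx_inv.
rewrite ler_sqrt; last by rewrite addr_ge0// mulr_ge0// mulr_ge0// sqr_ge0.
rewrite lerD2l ler_wpM2r//.
by rewrite ler_peMr// exprn_ege1.
Qed.
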